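(* Up to isomorphism, there are only countably many locally compact Polish iso-singular groups. Among them only three are infinite: one compact, one discrete and one non-compact non-discrete. Each locally compact Polish iso-singular group $G$ is of exponent $4$ (that is, $x^4 = e_G$ for any $x \in G$) and totally disconnected. If such a $G$ is finite, it is uniquely determined (up to isomorphism) by its cardinality.
   Context: A topological group is Polish if it is separable and completely metrizable. Isomorphisms of topological groups are group isomorphisms that are homeomorphisms. $e_G$ is the neutral element of $G$. A group $H$ is Boolean if $x^2 = e_H$ for all $x \in H$. A base pair is a pair $(H,p)$ where $H$ is a topological Abelian group and $p \in H$ satisfies $p^2 = e_H \neq p$. For a base pair $(H,p)$, $H \times_p \{-1,1\}$ denotes the topological group with underlying space $H \times \{-1,1\}$ (product topology, $\{-1,1\}$ discrete) and multiplication $(x,j)\cdot(y,k) = (xy,jk)$ if $j=1$; $(xy^{-1},jk)$ if $j=-1$, $k=1$; $(xy^{-1}p,jk)$ if $j=k=-1$. A topological group is iso-singular if it is isomorphic to $(H \times_p \{-1,1\}) \times_{\tilde{p}} \{-1,1\}$ for some base pair $(H,p)$ with $H$ Boolean, where $\tilde{p} = (p,1)$ (in this case $H \times_p \{-1,1\}$ is Abelian and $(H \times_p \{-1,1\},\tilde p)$ is again a base pair). *)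

(* Defs.v *)
From HB Require Import structures.
From mathcomp Require Import all_boot.
From mathcomp Require Import all_classical all_reals.
From mathcomp Require Import topology.

Set Implicit Arguments.
Unset Strict Implicit.
Unset Printing Implicit Defensive.

Local Open Scope classical_set_scope.
Local Open Scope group_scope.

HB.structure Definition PreTopologicalGroup := {G of Topological G & Group G}.

HB.mixin Record PreTopologicalGroup_isTopologicalGroup G
    of PreTopologicalGroup G := {
  mulg_continuous : continuous (fun xy : G * G => xy.1 * xy.2) ;
  invg_continuous : continuous (fun x : G => x^-1)
}.

#[short(type="topologicalGroupType")]
HB.structure Definition TopologicalGroup :=
  {G of PreTopologicalGroup G & PreTopologicalGroup_isTopologicalGroup G}.

Definition homeomorphism (T U : topologicalType) (f : T -> U) : Prop :=
  exists g : U -> T, [/\ cancel f g, cancel g f, continuous f & continuous g].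

Definition topgroup_isomorphic (G H : topologicalGroupType) : Prop :=
  exists2 f : G -> H, {morph f : x y / x * y} & homeomorphism f.

Definition separable_space (T : topologicalType) : Prop :=
  exists2 A : set T, countable A & dense A.

(* Completeness is unfolded because [completeType] requires a chosen point. *)
Definition completely_metrizable (R : realType) (T : topologicalType) : Prop :=
  exists M : metricType R,
    (forall F : set_system M,
       ProperFilter F -> cauchy F -> exists x : M, F --> x) /\
    exists f : T -> M, homeomorphism f.

Definition polish (R : realType) (T : topologicalType) : Prop :=
  separable_space T /\ completely_metrizable R T.

Definition discrete_space (T : topologicalType) : Prop :=
  forall A : set T, open A.

Definition boolean_group (G : groupType) : Prop := forall x : G, x ^+ 2 = 1.

Record basePair := BasePair {
  bp_group :> topologicalGroupType ;
  bp_mulC : commutative (@mul bp_group) ;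
  bp_point : bp_group ;
  bp_sqr : bp_point ^+ 2 = 1 ;
  bp_neq1 : bp_point <> 1
}.

(* The carrier of H x_p {-1,1}. The boolean b stands for the sign (-1)^b, so
   that the product of signs is the exclusive or (+); the topology of [bool]
   is discrete. *)
Definition base_prod (B : basePair) : Type := (B * bool)%type.

HB.instance Definition _ (B : basePair) :=
  Topological.copy (base_prod B) (B * bool)%type.

Section BaseProd.
Variable B : basePair.
Local Notation p := (bp_point B).
Implicit Types (x y : B) (u v w : base_prod B).

Definition base_prod_one : base_prod B := (1, false).

Definition base_prod_mul u v : base_prod B :=
  let: (x, j) := u in let: (y, k) := v in
  match j, k with
  | false, _ => (x * y, j (+) k)
  | true, false => (x * y^-1, j (+) k)
  | true, true => (x * y^-1 * p, j (+) k)
  end.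

Definition base_prod_inv u : base_prod B :=
  let: (x, j) := u in (if j then x * p else x^-1, j).

Let mulC : commutative (@mul B) := @bp_mulC B.

Let mulpp : p * p = 1. Proof. exact: bp_sqr. Qed.

Let invp : p^-1 = p. Proof. by apply: (mulgI p); rewrite mulgV mulpp. Qed.

Let invMC x y : (x * y)^-1 = x^-1 * y^-1. Proof. by rewrite invgM mulC. Qed.

Let mulAC x y (z : B) : x * y * z = x * z * y.
Proof. by rewrite -mulgA (mulC y) mulgA. Qed.

Fact base_prod_mulA : associative base_prod_mul.
Proof.
move=> [x [|]] [y [|]] [z [|]] /=; congr pair;
  rewrite ?invMC ?invgK ?invp ?mulgA //.
all: by rewrite !(mulAC _ _ p) -?(mulgA _ p p) ?mulpp ?mulg1.
Qed.

Fact base_prod_mul1 : left_id base_prod_one base_prod_mul.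
Proof. by move=> [x [|]] /=; rewrite mul1g. Qed.

Fact base_prod_1mul : right_id base_prod_one base_prod_mul.
Proof. by move=> [x [|]] /=; rewrite ?invg1 mulg1. Qed.

Fact base_prod_mulV : left_inverse base_prod_one base_prod_inv base_prod_mul.
Proof.
move=> [x [|]] /=; last by rewrite mulVg.
by rewrite mulAC -(mulgA x) mulpp mulg1 mulgV.
Qed.

Fact base_prod_Vmul : right_inverse base_prod_one base_prod_inv base_prod_mul.
Proof.
move=> [x [|]] /=; last by rewrite mulgV.
by rewrite invMC invp mulgA mulgV mul1g mulpp.
Qed.

HB.instance Definition _ := isGroup.Build (base_prod B)
  base_prod_mulA base_prod_mul1 base_prod_1mul base_prod_mulV base_prod_Vmul.

Let cont_mul (T : topologicalType) (f g : T -> B) (t : T) :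
  {for t, continuous f} -> {for t, continuous g} ->
  {for t, continuous (fun s => f s * g s)}.
Proof.
move=> cf cg; apply: (@continuous_comp _ _ _ (fun s => (f s, g s))
  (fun xy : B * B => xy.1 * xy.2)); last exact: mulg_continuous.
exact: cvg_pair.
Qed.

Let cont_inv (T : topologicalType) (f : T -> B) (t : T) :
  {for t, continuous f} -> {for t, continuous (fun s => (f s)^-1)}.
Proof. by move=> cf; apply: continuous_comp => //; exact: invg_continuous. Qed.

Let cont_pair (T : topologicalType) (f : T -> B) (b : bool) (t : T) :
  {for t, continuous f} ->
  {for t, continuous (fun s => (f s, b) : base_prod B)}.
Proof.
move=> cf; apply: (@cvg_pair _ _ _ _ (nbhs (f t)) (nbhs b)) => //.
exact: cvg_cst.
Qed.

Fact base_prod_mul_continuous :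
  continuous (fun uv : base_prod B * base_prod B => uv.1 * uv.2).
Proof.
move=> [[x j] [y k]]; rewrite /continuous_at.
pose h (uv : base_prod B * base_prod B) : base_prod B :=
  match j, k with
  | false, _ => (uv.1.1 * uv.2.1, j (+) k)
  | true, false => (uv.1.1 * uv.2.1^-1, j (+) k)
  | true, true => (uv.1.1 * uv.2.1^-1 * p, j (+) k)
  end.
have c1 : {for ((x, j) : base_prod B, (y, k) : base_prod B),
    continuous (fun uv : base_prod B * base_prod B => uv.1.1)}.
  apply: (@continuous_comp _ (base_prod B) B (fun uv => uv.1) (fun u => u.1)).
    exact: cvg_fst.
  exact: (@cvg_fst B bool).
have c2 : {for ((x, j) : base_prod B, (y, k) : base_prod B),
    continuous (fun uv : base_prod B * base_prod B => uv.2.1)}.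
  apply: (@continuous_comp _ (base_prod B) B (fun uv => uv.2) (fun u => u.1)).
    exact: cvg_snd.
  exact: (@cvg_fst B bool).
have ch : h uv @[uv --> (((x, j) : base_prod B), ((y, k) : base_prod B))]
    --> ((x, j) : base_prod B) * ((y, k) : base_prod B).
  suff : {for ((x, j) : base_prod B, (y, k) : base_prod B), continuous h}.
    by rewrite /continuous_at /h /mul/=; case: (j) (k) => [] [].
  rewrite /h; case: (j) (k) c1 c2 => [] [] c1 c2; apply: cont_pair.
  - by apply: cont_mul; [apply: cont_mul => //; exact: cont_inv|exact: cvg_cst].
  - by apply: cont_mul => //; exact: cont_inv.
  - exact: cont_mul.
  - exact: cont_mul.
apply: cvg_trans ch; apply: near_eq_cvg.
have nj : \forall u \near ((x, j) : base_prod B), u.2 = j.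
  exists ([set: B], [set j]); last by case=> a b [].
  by split; [exact: filterT | exact: discrete_set1].
have nk : \forall u \near ((y, k) : base_prod B), u.2 = k.
  exists ([set: B], [set k]); last by case=> a b [].
  by split; [exact: filterT | exact: discrete_set1].
exists ([set u : base_prod B | u.2 = j], [set u : base_prod B | u.2 = k]) => //.
by case=> -[a b] [c d] [/= -> ->].
Qed.

Fact base_prod_inv_continuous : continuous (fun u : base_prod B => u^-1).
Proof.
move=> [x j]; rewrite /continuous_at.
pose h (u : base_prod B) : base_prod B := (if j then u.1 * p else u.1^-1, j).
have c1 : {for ((x, j) : base_prod B),
    continuous (fun u : base_prod B => u.1)} by exact: cvg_fst.
have ch : h u @[u --> ((x, j) : base_prod B)] --> ((x, j) : base_prod B)^-1.
  suff : {for ((x, j) : base_prod B), continuous h}.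
    by rewrite /continuous_at /h /inv/=; case: (j).
  rewrite /h; case: (j) c1 => c1; apply: cont_pair.
  - by apply: cont_mul => //; exact: cvg_cst.
  - exact: cont_inv.
apply: cvg_trans ch; apply: near_eq_cvg.
exists ([set: B], [set j]); last by case=> a b [_ /= ->].
by split; [exact: filterT | exact: discrete_set1].
Qed.

HB.instance Definition _ := PreTopologicalGroup_isTopologicalGroup.Build
  (base_prod B) base_prod_mul_continuous base_prod_inv_continuous.

Fact base_prod_mulC :
  boolean_group B -> commutative (@mul (base_prod B)).
Proof.
move=> B2; have inv x : x^-1 = x.
  by apply: (mulgI x); rewrite mulgV; apply/esym; exact: B2.
by move=> [x [|]] [y [|]]; rewrite /mul/= ?inv (mulC x).
Qed.

Definition tilde_point : base_prod B := (p, false).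

Fact tilde_point_sqr : tilde_point ^+ 2 = 1.
Proof. by rewrite /tilde_point expgS expg1 /mul/= mulpp. Qed.

Fact tilde_point_neq1 : tilde_point <> 1.
Proof. by case=> /bp_neq1. Qed.

Definition tilde_base (B2 : boolean_group B) : basePair :=
  BasePair (base_prod_mulC B2) tilde_point_sqr tilde_point_neq1.

End BaseProd.

Definition iso_singular (G : topologicalGroupType) : Prop :=
  exists (B : basePair) (B2 : boolean_group B),
    topgroup_isomorphic G (base_prod (tilde_base B2)).

Definition lcp_iso_singular (R : realType) (G : topologicalGroupType) : Prop :=
  [/\ locally_compact [set: G], polish R G & iso_singular G].

(* Main.v *)
Require Import Defs.
From HB Require Import structures.
From mathcomp Require Import finmap.
From mathcomp Require Import all_boot order ssralg ssrnum ssrint ring.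
From mathcomp Require Import all_classical all_reals.
From mathcomp Require Import topology.

(* The heart of the matter is the structure of a locally compact Polish Boolean
   group B with a marked involution p.

   If V is a compact neighbourhood of 1, then VV lies in FV for a finite set F,
   so that <F>V is a compact open subgroup. Small open subgroups come from
   Bogolyubov's theorem: if k translates of A cover F_2^n, then A + A + A + A
   contains a subgroup cut out by at most k^2 characters. As k^2 does not
   depend on n, these subgroups have, along the finite subgroups generated by
   initial segments of a dense sequence, a limit of finite index, whose closure
   is an open subgroup contained in a small neighbourhood of 1.

   Hence countably many continuous characters c_0, c_1, ... separate points,
   with c_0(p) <> 0 and c_m(p) = 0 for m > 0. For a compact open subgroup K
   containing p, the c_m that do not vanish on the common kernel in K of their
   predecessors identify K with a power of Z/2, and likewise characters trivial
   on K identify B/K with a direct sum of copies of Z/2. So B is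
   Z/2 x (Z/2)^I x (Z/2)^(J), with p generating the first factor, where K may be
   taken to be B if B is compact and {1, p} if B is discrete, while I and J are
   both infinite if B is neither. *)

Set Implicit Arguments.
Unset Strict Implicit.
Unset Printing Implicit Defensive.

Local Open Scope classical_set_scope.
Local Open Scope group_scope.

(** * Fourier analysis on F_2^n and Bogolyubov's theorem *)

Section Bogolyubov.
Import GRing.Theory Num.Theory Order.TTheory.
Local Open Scope ring_scope.
Variable n : nat.
Local Notation V := {ffun 'I_n -> bool}.
Implicit Types (S v w x y z : V).

Definition vadd v w : V := [ffun i => v i (+) w i].

Definition chi S v : int := \prod_i (-1) ^+ (S i && v i).

Lemma vaddA : associative vadd.
Proof. by move=> v w x; apply/ffunP => i; rewrite !ffunE addbA. Qed.

Lemma vadd_eq0 v w : (vadd v w == [ffun=> false]) = (v == w).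
Proof.
apply/eqP/eqP => [/ffunP e|->]; apply/ffunP => i; last by rewrite !ffunE addbb.
by have := e i; rewrite !ffunE; case: (v i) (w i) => [] [].
Qed.

Lemma chi_vadd S v w : chi S (vadd v w) = chi S v * chi S w.
Proof.
rewrite /chi -big_split/=; apply: eq_bigr => i _.
by rewrite ffunE -signr_addb andb_addr.
Qed.

Lemma chi0 v : chi [ffun=> false] v = 1.
Proof. by rewrite /chi big1// => i _; rewrite ffunE expr0. Qed.

Lemma chi_v0 S : chi S [ffun=> false] = 1.
Proof. by rewrite /chi big1// => i _; rewrite ffunE andbF expr0. Qed.

Lemma chi_delta S i : chi S [ffun j => j == i] = (-1) ^+ S i.
Proof.
rewrite /chi (bigD1 i)//= big1 ?mulr1 => [|j /negPf ji]; rewrite ffunE.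
  by rewrite eqxx andbT.
by rewrite ji andbF.
Qed.

Lemma chi_le1 S v : `|chi S v| <= 1.
Proof.
by rewrite /chi normr_prod big1// => i _; rewrite normrX normrN1 expr1n.
Qed.

(** The sum factors as the product over i of 1 + (-1)^(v_i), and any i with v_i = 1 contributes a
    factor 0. *)
Lemma sum_chi v : \sum_S chi S v = if v == [ffun=> false] then 2 ^+ n else 0.
Proof.
rewrite /chi -(bigA_distr_bigA (fun i b => (-1) ^+ (b && v i))).
case: ifPn => [/eqP ->|/eqP v0].
  rewrite (eq_bigr (fun=> 2)); first by rewrite big_const_ord iter_mulr_1.
  by move=> i _; rewrite big_bool !ffunE.
have [i vi] : exists i, v i.
  apply/existsP; apply: contra_notT v0; rewrite negb_exists => /forallP v0.
  by apply/ffunP => i; rewrite ffunE; exact/negbTE.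
by rewrite (bigD1 i)//= big_bool vi /= addNr mul0r.
Qed.

Variables (A : {set V}) (k : nat).
Hypothesis A_large : (2 ^ n <= k * #|A|)%N.

Let f S := \sum_(x in A) chi S x.

(** Parseval's identity: once the squares are expanded, orthogonality leaves only the diagonal pairs
    x = y. *)
Lemma sum_sqr_fourier : \sum_S f S ^+ 2 = 2 ^+ n * #|A|%:R.
Proof.
transitivity (\sum_(x in A) \sum_(y in A) \sum_S chi S (vadd x y)).
  rewrite [RHS](eq_bigr (fun x => \sum_S \sum_(y in A) chi S (vadd x y)));
    last by move=> x _; rewrite exchange_big.
  rewrite [RHS]exchange_big; apply: eq_bigr => S _.
  rewrite expr2 /f big_distrlr; apply: eq_bigr => x _.
  by apply: eq_bigr => y _; rewrite chi_vadd.
rewrite (eq_bigr (fun=> 2 ^+ n)); first by rewrite sumr_const mulr_natr.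
move=> x xA; rewrite (bigD1 x)//= sum_chi vadd_eq0 eqxx big1 ?addr0// => y.
by case/andP=> _ /negPf yx; rewrite sum_chi vadd_eq0 eq_sym yx.
Qed.

Definition sum4 z := exists x1 x2 x3 x4,
  [/\ x1 \in A, x2 \in A, x3 \in A & x4 \in A] /\
  z = vadd (vadd x1 x2) (vadd x3 x4).

(** Up to the factor 2^n, this sum counts the representations of z as a sum of four elements of
    A. *)
Lemma sum_fourier4 z : ~ sum4 z -> \sum_S f S ^+ 4 * chi S z = 0.
Proof.
move=> zA.
pose P (q : V * V) := (q.1 \in A) && (q.2 \in A).
have f2 S : f S ^+ 2 = \sum_(q | P q) chi S (vadd q.1 q.2).
  rewrite expr2 /f big_distrlr pair_big; apply: eq_bigr => q _.
  by rewrite chi_vadd.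
transitivity (\sum_(q | P q) \sum_(r | P r) \sum_S
    chi S (vadd (vadd (vadd q.1 q.2) (vadd r.1 r.2)) z)).
  rewrite [RHS](eq_bigr (fun q => \sum_S \sum_(r | P r)
    chi S (vadd (vadd (vadd q.1 q.2) (vadd r.1 r.2)) z)));
    last by move=> q _; rewrite exchange_big.
  rewrite [RHS]exchange_big; apply: eq_bigr => S _.
  rewrite (exprM _ 2 2) f2 expr2 big_distrlr big_distrl; apply: eq_bigr => q _.
  by rewrite big_distrl; apply: eq_bigr => r _; rewrite !chi_vadd.
rewrite big1// => q /andP[q1 q2]; rewrite big1// => r /andP[r1 r2].
rewrite sum_chi vadd_eq0; case: eqP => // qr; case: zA.
by exists q.1, q.2, r.1, r.2.
Qed.

(** The characters are those of the large spectrum [Sp]. If all of them are 1 at z, the terms over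
    [Sp] contribute at least a^4 to the fourth-moment sum at z, whereas Parseval keeps the others
    below that in absolute value. So the sum is not 0. *)
Lemma bogolyubov : exists sigma : 'I_(k ^ 2) -> V,
  forall z, (forall l, chi (sigma l) z = 1) -> sum4 z.
Proof.
pose a : int := #|A|%:R.
(* The condition is |f S| >= a / sqrt k, squared and cleared of denominators to stay among the
   integers. *)
pose Sp : {set V} := [set S | a ^+ 2 <= (f S) ^+ 2 * k%:R]%SET.
have a_gt0 : 0 < a.
  rewrite ltr0n lt0n; apply/eqP => a0; move: A_large; rewrite a0 muln0.
  by rewrite leqn0 expn_eq0.
have k_gt0 : (0 : int) < k%:R.
  rewrite ltr0n lt0n; apply/eqP => k0; move: A_large; rewrite k0 mul0n.
  by rewrite leqn0 expn_eq0.
have large : 2 ^+ n <= k%:R * a :> int.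
  by rewrite /a -natrM -natrX ler_nat.
have f0 : f [ffun=> false] = a.
  by rewrite /f (eq_bigr (fun=> 1)) ?sumr_const// => x _; rewrite chi0.
have Sp_card : (#|Sp| <= k ^ 2)%N.
  have : #|Sp|%:R * a ^+ 2 <= k%:R ^+ 2 * a ^+ 2 :> int.
    apply: (@le_trans _ _ (\sum_(S in Sp) f S ^+ 2 * k%:R)).
      rewrite mulr_natl -sumr_const; apply: ler_sum => S.
      by rewrite inE.
    apply: (@le_trans _ _ (\sum_S f S ^+ 2 * k%:R)).
      rewrite [leRHS](bigID (mem Sp))/= lerDl sumr_ge0// => S _.
      by rewrite mulr_ge0 ?sqr_ge0// ltW.
    rewrite -big_distrl/= sum_sqr_fourier -/a.
    have := ler_wpM2r (mulr_ge0 (ltW a_gt0) (ltW k_gt0)) large.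
    by congr (_ <= _); ring.
  by rewrite ler_pM2r ?exprn_gt0// -natrX ler_nat.
(* Indices beyond the cardinality of [Sp] get the trivial character, which imposes no condition. *)
exists (fun l => nth [ffun=> false] (enum Sp) l) => z chi1.
apply: contrapT => /sum_fourier4.
have {}chi1 S : S \in Sp -> chi S z = 1.
  move=> SSp; have iS : (index S (enum Sp) < k ^ 2)%N.
    by rewrite (leq_trans _ Sp_card)// cardE index_mem mem_enum.
  by rewrite -(chi1 (Ordinal iS)) nth_index// mem_enum.
rewrite (bigID (mem Sp))/= => /eqP; rewrite addr_eq0 => /eqP sum0.
set s1 := \sum_(S in Sp) f S ^+ 2.
have s1_ge : a ^+ 2 <= s1.
  rewrite /s1 (bigD1 [ffun=> false])/=; last first.
    by rewrite inE f0 ler_peMr ?sqr_ge0// -[1]/(1%:R) ler_nat -(ltr0n int).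
  by rewrite f0 lerDl sumr_ge0// => S _; rewrite sqr_ge0.
have hi : a ^+ 4 <= \sum_(S in Sp) f S ^+ 4 * chi S z.
  rewrite (bigD1 [ffun=> false])/=; last first.
    by rewrite inE f0 ler_peMr ?sqr_ge0// -[1]/(1%:R) ler_nat -(ltr0n int).
  rewrite f0 chi0 mulr1 lerDl sumr_ge0// => S /andP[SSp _].
  by rewrite chi1// mulr1 (exprM _ 2 2) sqr_ge0.
(* Outside [Sp], k f^2 < a^2 and hence k f^4 <= a^2 f^2; by Parseval the f^2 there add up to 2^n a -
   s1. *)
have lo : k%:R * (\sum_(S in Sp) f S ^+ 4 * chi S z) <=
    a ^+ 2 * (2 ^+ n * a - s1).
  rewrite sum0 -sum_sqr_fourier [X in _ <= _ * (X - _)](bigID (mem Sp))/= -/s1.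
  rewrite addrAC subrr add0r.
  rewrite -sumrN !big_distrr/=; apply: ler_sum => S.
  rewrite inE -ltNge => SSp.
  have := chi_le1 S z; rewrite ler_norml => /andP[c1 c2].
  have := sqr_ge0 (f S); rewrite (exprM _ 2 2); move: SSp.
  set F := f S ^+ 2; move=> Fk F_ge0.
  apply: (@le_trans _ _ (k%:R * F ^+ 2)).
    by rewrite ler_pM2l// -mulrN ler_piMr ?sqr_ge0// lerNl.
  by rewrite expr2 mulrCA mulrA mulrAC -mulrA mulrC ler_wpM2r// ?ltW// mulrC.
have h1 : k%:R * a ^+ 4 <= k%:R * (\sum_(S in Sp) f S ^+ 4 * chi S z).
  by rewrite ler_pM2l.
have h2 : a ^+ 2 * (2 ^+ n * a - s1) <= a ^+ 2 * (k%:R * a * a - a ^+ 2).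
  by rewrite ler_wpM2l ?sqr_ge0// lerB// ler_wpM2r// ltW.
have h3 : 0 < a ^+ 4 by rewrite exprn_gt0.
have := le_trans h1 (le_trans lo h2).
rewrite (_ : a ^+ 2 * _ = k%:R * a ^+ 4 - a ^+ 4); last by ring.
by rewrite leNgt ltrBlDr ltrDl h3.
Qed.

End Bogolyubov.

(** * Translations and neighbourhoods of 1 *)

Section TopologicalGroup.
Variable H : topologicalGroupType.
Implicit Types (x y z : H) (A U V : set H).

Lemma mulgl_continuous x : continuous (fun y => x * y).
Proof.
move=> y; apply: (@continuous_comp _ _ _ (fun s => (x, s))
  (fun xy : H * H => xy.1 * xy.2)); last exact: mulg_continuous.
by apply: cvg_pair; [exact: cvg_cst | exact: cvg_id].
Qed.

Lemma nbhs_mulgl x A : nbhs x A <-> nbhs 1 [set y | A (x * y)].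
Proof.
split=> [xA|].
  by have := @mulgl_continuous x 1; rewrite /continuous_at mulg1 => /(_ _ xA).
move=> nA; have : nbhs x (mul x^-1 @^-1` [set y | A (x * y)]).
  by apply: mulgl_continuous; rewrite mulVg.
by apply: filterS => y; rewrite /= mulVKg.
Qed.

Lemma nbhs1_mul U : nbhs 1 U ->
  exists2 V, nbhs 1 V & forall x y, V x -> V y -> U (x * y).
Proof.
move=> nU; have := @mulg_continuous H (1, 1); rewrite /continuous_at/= mulg1.
move=> /(_ U nU) [[V W] [/= nV nW] VWU].
exists (V `&` W); first exact: filterI.
by move=> x y [Vx _] [_ Wy]; exact: (VWU (x, y)).
Qed.

(** In a Boolean group, where every element is its own inverse, these are exactly the subgroups. *)
Definition subgrp A := A 1 /\ forall x y, A x -> A y -> A (x * y).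

End TopologicalGroup.

(** * Boolean topological groups and their compact open subgroups *)

Section BooleanGroup.
Variables (H : topologicalGroupType) (H2 : boolean_group H).
Implicit Types (x y z : H) (A K U V : set H).

Lemma bmulgg x : x * x = 1. Proof. exact: H2. Qed.

Lemma binvg x : x^-1 = x. Proof. by apply: (mulgI x); rewrite mulgV bmulgg. Qed.

Lemma bmulgK x : involutive (mul x).
Proof. by move=> y; rewrite mulgA bmulgg mul1g. Qed.

Lemma bmulgC : commutative (@mul H).
Proof. by move=> x y; rewrite -[RHS]binvg invgM !binvg. Qed.

Lemma bmulgACA : @interchange H mul mul.
Proof. by move=> x y z t; rewrite !mulgA -(mulgA x) (bmulgC y) mulgA. Qed.

Lemma subgrp_nbhs K x : subgrp K -> nbhs 1 K -> K x -> nbhs x K.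
Proof.
move=> [_ KM] nK Kx; apply/nbhs_mulgl; apply: filterS nK => y; exact: KM.
Qed.

Lemma subgrp_mull K x y : subgrp K -> K x -> K (x * y) -> K y.
Proof. by move=> [_ KM] Kx /(KM _ _ Kx); rewrite bmulgK. Qed.

Lemma subgrp_closed K : subgrp K -> nbhs 1 K -> closed K.
Proof.
move=> gK nK x /(_ [set y | K (x * y)]) [|y [Ky Kxy]].
  by apply/nbhs_mulgl; apply: filterS nK => y /=; rewrite bmulgK.
by apply: (subgrp_mull (x := y)) => //; rewrite bmulgC.
Qed.

Section Dense.
Variable d : nat -> H.
Hypothesis d_dense : forall x U, nbhs x U -> exists j, U (d j).

(** The product of A with the finite subgroup generated by d_0, ..., d_(n-1), as [chainE] shows. *)
Fixpoint chain A n : set H :=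
  if n is m.+1 then [set y | chain A m y \/ chain A m (d m * y)] else A.

Lemma chain_sub A m n : m <= n -> chain A m `<=` chain A n.
Proof.
elim: n => [|n IH]; first by rewrite leqn0 => /eqP->.
by rewrite leq_eqVlt => /predU1P[->//|/IH mn] x /mn; left.
Qed.

Lemma chain_subgrp A n : subgrp A -> subgrp (chain A n).
Proof.
move=> gA; elim: n => [//|n [g1 gM]]; split; first by left.
move=> x y [Ax|Ax] [Ay|Ay] /=.
- by left; exact: gM.
- by right; rewrite mulgA (bmulgC _ x) -mulgA; exact: gM.
- by right; rewrite mulgA; exact: gM.
- by left; have := gM _ _ Ax Ay; rewrite bmulgACA bmulgg mul1g.
Qed.

Lemma chain_gen A n j : A 1 -> j < n -> chain A n (d j).
Proof.
move=> A1 jn; apply: (chain_sub (m := j.+1)) => //=; right; rewrite bmulgg.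
exact: (@chain_sub A 0).
Qed.

Lemma chainE A n y :
  chain A n y <-> exists2 g, chain [set 1] n g & A (g * y).
Proof.
elim: n y => [|n IH] y /=.
  by split=> [Ay|[g ->]]; [exists 1 => //|]; rewrite mul1g.
split=> [[/IH|/IH]|].
- by move=> [g g1 gy]; exists g => //; left.
- move=> [g g1 gy]; exists (g * d n); last by rewrite -mulgA.
  by right; rewrite (bmulgC g) bmulgK.
move=> [g [g1|g1] gy]; first by left; apply/IH; exists g.
by right; apply/IH; exists (d n * g); rewrite // bmulgACA bmulgg mul1g.
Qed.

Lemma chain_compact A n : compact A -> compact (chain A n).
Proof.
move=> cA; elim: n => [//|n IH]; rewrite (_ : chain A n.+1 =
    chain A n `|` (fun y => d n * y) @` chain A n).
  apply: compactU => //; apply: continuous_compact => //.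
  by apply: continuous_subspaceT; exact: mulgl_continuous.
apply/seteqP; split=> x /= [Ax|]; [by left| |by left|].
  by right; exists (d n * x); rewrite ?bmulgK.
by move=> [y Ay <-]; right; rewrite bmulgK.
Qed.

(** For each x some d_j x lies in the interior of V, and the same j serves all points near x;
    compactness bounds j. *)
Lemma dense_cover A V : compact A -> nbhs 1 V ->
  exists n, forall x, A x -> exists2 j, j < n & V (d j * x).
Proof.
move=> /compact_near_coveringP cA nV.
have [|n _ nP] := cA nat \oo (fun n x => exists2 j, j < n & V (d j * x)) _.
  move=> x Ax; have [j /= Vj] : exists j, V^° (x * d j).
    apply: (@d_dense x [set y | V^° (x * y)]); apply/nbhs_mulgl.
    by apply: filterS (nbhs_interior nV) => y; rewrite /= bmulgK.
  exists ([set y | V (d j * y)], [set n | j < n]); last first.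
    by move=> [y n] [Vy jn] /=; exists j.
  split=> /=; last by exists j.+1.
  apply: (@mulgl_continuous H (d j) x); rewrite bmulgC.
  exact: Vj.
by exists n => x Ax; apply: (nP n) => //=.
Qed.

Lemma compact_open_subgroup V : compact V -> nbhs 1 V ->
  exists K, [/\ subgrp K, compact K & nbhs 1 K].
Proof.
move=> cV nV.
pose VV := (fun xy : H * H => xy.1 * xy.2) @` (V `*` V).
have [|n nP] := @dense_cover VV V _ nV.
  apply: continuous_compact; last exact: compact_setX.
  by apply: continuous_subspaceT; exact: mulg_continuous.
have V1 := nbhs_singleton nV.
exists (chain V n); split; last 2 first.
- exact: chain_compact.
- by apply: filterS nV; exact: (@chain_sub V 0).
have g1 : subgrp (chain [set 1] n).
  by apply: chain_subgrp; split=> // x y -> ->; rewrite mulg1.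
split; first exact: (@chain_sub V 0).
move=> x y /chainE[g gx Vx] /chainE[h hy Vy].
(* Both g x and h y lie in V, and some d_j brings their product back into V. *)
have [|j jn Vj] := nP (g * x * (h * y)); first by exists (g * x, h * y).
apply/chainE; exists (d j * (g * h)); last by rewrite -mulgA (bmulgACA g).
by apply: g1.2; [exact: chain_gen|exact: g1.2].
Qed.

End Dense.
End BooleanGroup.

(** * Homomorphisms from F_2^n given by initial segments of a sequence *)

Section Combination.
Variables (H : topologicalGroupType) (H2 : boolean_group H) (e : nat -> H).

Definition comb n (v : {ffun 'I_n -> bool}) : H :=
  foldr (fun i y => if v i then e i * y else y) 1 (enum 'I_n).

Lemma comb_vadd n : {morph @comb n : v w / vadd v w >-> v * w}.
Proof.
move=> v w; rewrite /comb; elim: (enum 'I_n) => [|i s IH] /=.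
  by rewrite mulg1.
rewrite ffunE IH; case: (v i) (w i) => [] [] /=.
- by rewrite (bmulgACA H2) (bmulgg H2) mul1g.
- by rewrite mulgA.
- by rewrite !mulgA (bmulgC H2 (e i)).
- by [].
Qed.

Lemma comb_delta n (i : 'I_n) : comb [ffun j => j == i] = e i.
Proof.
rewrite /comb; have : i \in enum 'I_n by rewrite mem_enum.
have := enum_uniq 'I_n; elim: (enum 'I_n) => //= j s IH /andP[js us].
rewrite inE ffunE eq_sym; have [eji _|_ /=] := eqVneq j i; last exact: IH.
rewrite {}eji in js *.
suff -> : foldr (fun k y =>
    if [ffun l => l == i] k then e k * y else y) 1 s = 1.
  by rewrite mulg1.
elim: s js {IH us} => //= k s IH; rewrite inE negb_or ffunE eq_sym.
by case/andP=> /negbTE -> /IH.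
Qed.

Lemma comb_subgrp (K : set H) n (v : {ffun 'I_n -> bool}) :
  subgrp K -> (forall i, K (e i)) -> K (comb v).
Proof.
move=> [K1 KM] eK; rewrite /comb; elim: (enum 'I_n) => //= i s IH.
by case: ifP => // _; exact: KM.
Qed.

End Combination.

(** * Small open subgroups *)

Section SmallSubgroups.
Variables (H : topologicalGroupType) (H2 : boolean_group H) (d : nat -> H).
Hypothesis d_dense : forall (x : H) (U : set H), nbhs x U -> exists j, U (d j).

(** As the translates of A by the t_j cover the space, (j, w) -> t_j + w maps k copies of A onto
    it. *)
Lemma card_cover n (A : {set {ffun 'I_n -> bool}}) k
    (t : 'I_k -> {ffun 'I_n -> bool}) :
  (forall v, exists j, vadd (t j) v \in A) -> (2 ^ n <= k * #|A|)%N.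
Proof.
move=> cov; rewrite -[k in (k * _)%N]card_ord -cardsT -cardsX.
apply: (leq_trans _ (leq_imset_card
  (fun q : 'I_k * {ffun 'I_n -> bool} => vadd (t q.1) q.2) _)).
rewrite -[2]card_bool -[n in (_ ^ n)%N]card_ord -card_ffun -cardsT.
apply/subset_leq_card; apply/fintype.subsetP => v _; have [j jA] := cov v.
apply/imsetP; exists (j, vadd (t j) v); rewrite ?inE//=.
by rewrite vaddA; apply/ffunP => i; rewrite !ffunE addbb.
Qed.

(** The kernels furnished by Bogolyubov's theorem have a limit P along an ultrafilter. Its elements
    are products of four elements of [W], and the e_i meet at most 2^(k^2) of its cosets, which
    makes its closure open. *)
Lemma small_open_subgroup (K U : set H) :
  subgrp K -> compact K -> nbhs 1 K -> nbhs 1 U ->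
  exists L, [/\ subgrp L, nbhs 1 L & L `<=` U].
Proof.
move=> gK cK nK nU.
have [V3 nV3 V3U] := nbhs1_mul nU; have [V2 nV2 V23] := nbhs1_mul nV3.
have [V1 nV1 V12] := nbhs1_mul nV2.
(* Four factors of V1 come from Bogolyubov's theorem and V3 absorbs the passage
   to the closure. *)
pose W := V1 `&` K; have nW : nbhs 1 W by exact: filterI.
have [k kP] := dense_cover H2 d_dense cK nW.
(* Replacing the d_j outside K by 1 keeps all combinations inside K. *)
pose e j := if `[< K (d j) >] then d j else 1.
have eK j : K (e j) by rewrite /e; case: ifPn => [/asboolP//|_]; exact: gK.1.
have eE j : K (d j) -> e j = d j by rewrite /e => /asboolP ->.
pose A n : {set {ffun 'I_n -> bool}} := [set v | `[< W (comb e v) >]]%SET.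
have sigma_ex : forall n, exists s : 'I_(k ^ 2)%N -> {ffun 'I_n -> bool},
    k <= n -> forall z, (forall l, chi (s l) z = 1%R) -> sum4 (A n) z.
  move=> n; have [kn|] := leqP k n; last by exists (fun=> [ffun=> false]).
  have [|s sP] := @bogolyubov n (A n) k; last by exists s.
  (* The translations are by the basis vectors of index below k, which exist as soon as k <= n. *)
  pose t (j : 'I_k) := [ffun i => i == widen_ord kn j].
  apply: (@card_cover _ _ _ t) => v.
  have Kv : K (comb e v) by exact: comb_subgrp.
  have [j jk [Vj Kj]] := kP _ Kv; exists (Ordinal jk).
  rewrite inE; apply/asboolP; rewrite comb_vadd// comb_delta/= eE//.
  by apply: (subgrp_mull H2 gK Kv); rewrite bmulgC.
pose sigma n := projT1 (cid (sigma_ex n)).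
have sigmaP n : k <= n ->
    forall z, (forall l, chi (sigma n l) z = 1%R) -> sum4 (A n) z.
  exact: projT2 (cid (sigma_ex n)).
(* An ultrafilter decides every property of n, and being finer than [\oo] it lets n exceed any given
   bound. *)
have [F [FU Foo]] := @ultraFilterLemma nat \oo _.
have FF : Filter F by exact: filter_filter.
pose P : set H := [set x | \forall n \near F,
  exists2 z, x = comb e z & forall l, chi (sigma n l) z = 1%R].
have gP : subgrp P.
  split.
    apply: filterE => n; exists [ffun=> false].
      by rewrite /comb; elim: (enum 'I_n) => //= i s <-; rewrite ffunE.
    by move=> l; rewrite chi_v0.
  move=> x y Px Py; near=> n.
  have [z -> cz] : exists2 z, x = comb e z & forall l, chi (sigma n l) z = 1%R.
    by near: n.
  have [w -> cw] : exists2 z, y = comb e z & forall l, chi (sigma n l) z = 1%R.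
    by near: n.
  exists (vadd z w); first by rewrite comb_vadd.
  by move=> l; rewrite chi_vadd cz cw.
pose bit n l i := [exists j : 'I_n, (j == i :> nat) && sigma n l j].
(* The limit along [F] of the values of the n-th family of characters at the i-th basis vector. It
   ranges over a finite set because k^2 does not depend on n. *)
pose gamma i : {ffun 'I_(k ^ 2)%N -> bool} :=
  [ffun l => `[< \forall n \near F, bit n l i >]].
have gammaP i j : gamma i = gamma j -> P (e i * e j).
  move=> /ffunP gij.
  have bitE : \forall n \near F, forall l, bit n l i = bit n l j.
    have := @filter_forall _ _ (fun l => [set n | bit n l i = bit n l j]) F FF.
    apply => l; have := gij l; rewrite !ffunE.
    have [gi|gi] := pselect (F [set n | bit n l i]).
      rewrite (asboolT gi) => /esym/asboolP gj.
      by apply: filterS2 gi gj => n /= -> ->.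
    rewrite (asboolF gi) => /esym/asboolP gj.
    have [//|{}gi] := in_ultra_setVsetC [set n | bit n l i] FU.
    have [//|{}gj] := in_ultra_setVsetC [set n | bit n l j] FU.
    by apply: filterS2 gi gj => n /= /negP/negbTE -> /negP/negbTE ->.
  have big : \forall n \near F, maxn i j < n.
    by apply: Foo; exists (maxn i j).+1.
  apply: filterS2 bitE big => n bitE; rewrite gtn_max => /andP[ltin ltjn].
  have bitO l (m : 'I_n) : bit n l m = sigma n l m.
    apply/existsP/idP => [[h /andP[/eqP hm]]|sm]; last by exists m; rewrite eqxx.
    by rewrite (_ : h = m)//; exact/val_inj.
  pose i' := Ordinal ltin; pose j' := Ordinal ltjn.
  exists (vadd [ffun h => h == i'] [ffun h => h == j']).
    by rewrite comb_vadd// !comb_delta.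
  move=> l; rewrite chi_vadd !chi_delta -!bitO /= bitE.
  by rewrite -GRing.signr_addb addbb.
have closP x U' : closure P x -> nbhs 1 U' -> exists2 y, P y & U' (x * y).
  move=> Px nU'; have [|y [Py U'y]] := Px [set y | U' (x * y)]; last by exists y.
  by apply/nbhs_mulgl; apply: filterS nU' => y /=; rewrite bmulgK.
have gL : subgrp (closure P).
  split; first by apply: subset_closure; exact: gP.1.
  move=> x y Px Py N /nbhs_mulgl nN; have [N' nN' N'N] := nbhs1_mul nN.
  have [x' Px' Nx'] := closP _ _ Px nN'; have [y' Py' Ny'] := closP _ _ Py nN'.
  exists (x' * y'); split; first exact: gP.2.
  have := N'N _ _ Nx' Ny'.
  by rewrite /= (bmulgACA H2 x) !(bmulgK H2).
exists (closure P); split=> //; last first.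
  move=> x Px; have [y Py Vxy] := closP _ _ Px nV3.
  rewrite -[x]mulg1 -(bmulgg H2 y) mulgA; apply: V3U => //.
  have [n /= [[z -> cz] kn]] := filter_ex (filterI Py
    (Foo [set n | k <= n] (ex_intro2 _ _ k I (fun _ => id)))).
  have [x1 [x2 [x3 [x4 [[+ + + +] ->]]]]] := sigmaP n kn z cz.
  rewrite !inE => -[? _] [? _] [? _] [? _].
  by rewrite !(comb_vadd H2); apply: V23; exact: V12.
pose rep c := xget 0 [set i | gamma i = c].
have repP i : gamma (rep (gamma i)) = gamma i.
  by have := @xgetPex _ 0 [set j | gamma j = gamma i]; apply; exists i.
(* Near 1, each of the finitely many representatives that is outside the closed set [closure P]
   stays outside it after translation. Hence for d_j in both [E] and K, the representative of d_j
   lies in [closure P], and d_j with it. *)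
pose E := [set x | forall c, closure P (e (rep c) * x) ->
  closure P (e (rep c))].
have nE : nbhs 1 E.
  apply: filter_forall => c.
  have [Pc|nPc] := pselect (closure P (e (rep c))); first exact: filterE.
  have /existsNP[N /not_implyP[nN PN]] := nPc.
  have oN := nbhs_interior nN.
  apply: filterS (iffLR (nbhs_mulgl _ _) oN) => x /= Nx Px; case: PN.
  exact: (Px _ Nx).
suff EKP : (E `&` K)^° `<=` closure P.
  by apply: (filterS EKP); apply: nbhs_interior; exact: filterI.
move=> x nx; rewrite (closure_id (closure P)).1; last exact: closed_closure.
move=> O nO; have [j [Oj [Ej Kj]]] : exists j, (O `&` (E `&` K)) (d j).
  by apply: (@d_dense x); exact: filterI.
exists (d j); split => //.
have Pj : P (e (rep (gamma j)) * e j) by apply: gammaP; rewrite repP.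
have := Ej (gamma j); rewrite -(eE _ Kj) => /(_ (subset_closure Pj)) Pe.
rewrite eE// -(bmulgK H2 (e (rep (gamma j))) (d j)) -(eE _ Kj).
by apply: gL.2 => //; exact: subset_closure.
Unshelve. all: by end_near. Qed.

End SmallSubgroups.

(** * Homomorphisms to Z/2 *)

Section BooleanHom.
Variables (H : topologicalGroupType) (H2 : boolean_group H).
Implicit Types (x y z : H) (A K U V : set H).

Definition bool_hom (a : H -> bool) := forall x y, a (x * y) = a x (+) a y.

Lemma bool_hom1 a : bool_hom a -> a 1 = false.
Proof. by move=> ha; have := ha 1 1; rewrite mulg1 addbb. Qed.

(* By Zorn's lemma: a subgroup maximal among those that contain A but not x has
   index 2. *)
Lemma separating_bool_hom A x : subgrp A -> ~ A x ->
  exists a, [/\ bool_hom a, forall y, A y -> a y = false & a x].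
Proof.
move=> gA nAx; pose P := [set X | X = set0 \/ [/\ subgrp X, A `<=` X & ~ X x]].
have [F FP totF|M [PM Mmax]] := @Zorn_bigcup H P.
  have [[X [FX XN0]]|F0] := pselect (exists X, F X /\ X <> set0); last first.
    left; rewrite -subset0 => y [X FX Xy]; apply: F0; exists X; split => // X0.
    by rewrite X0 in Xy.
  have FE Y : F Y -> Y !=set0 -> [/\ subgrp Y, A `<=` Y & ~ Y x].
    by move=> /FP[-> [?]|].
  have [[X1 _] AX _] := FE _ FX (iffLR (set0P _) (introN eqP XN0)).
  right; split.
  - split; first by exists X.
    move=> y z [Y FY Yy] [Z FZ Zz].
    have [[_ YM] _ _] := FE Y FY (ex_intro _ _ Yy).
    have [[_ ZM] _ _] := FE Z FZ (ex_intro _ _ Zz).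
    have [YZ|ZY] := totF _ _ FY FZ.
      by exists Z => //; apply: ZM => //; exact: YZ.
    by exists Y => //; apply: YM => //; exact: ZY.
  - by move=> y Ay; exists X => //; exact: AX.
  - by move=> [Y FY Yx]; have [_ _] := FE Y FY (ex_intro _ _ Yx); apply.
case: PM => [M0|[gM AM nMx]].
  case: (Mmax A); last by right; split.
  rewrite M0; split; first by [].
  by move=> /(_ 1 gA.1).
(* Otherwise M and its coset by y would form a larger subgroup that misses x. *)
have Mx y : ~ M y -> M (y * x).
  move=> nMy; apply: contrapT => nMyx.
  case: (Mmax [set z | M z \/ M (y * z)]).
    split; first by move=> z; left.
    move=> /(_ y) My; apply: nMy; apply: My; right.
    by rewrite bmulgg//; exact: gM.1.
  right; split; last by case.
    split; first by left; exact: gM.1.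
    move=> u v [Mu|Mu] [Mv|Mv] /=.
    - by left; exact: gM.2.
    - by right; rewrite mulgA (bmulgC H2 y) -mulgA; exact: gM.2.
    - by right; rewrite mulgA; exact: gM.2.
    - by left; have := gM.2 _ _ Mu Mv; rewrite (bmulgACA H2) (bmulgg H2) mul1g.
  by move=> z /AM; left.
exists (fun y => ~~ `[< M y >]); split.
- move=> y z; case: (asboolP (M y)) => My; case: (asboolP (M z)) => Mz /=.
  + by rewrite asboolT//; exact: gM.2.
  + by rewrite asboolF// => /(subgrp_mull H2 gM My).
  + by rewrite asboolF// (bmulgC H2) => /(subgrp_mull H2 gM Mz).
  + rewrite asboolT//; have := gM.2 _ _ (Mx _ My) (Mx _ Mz).
    by rewrite (bmulgACA H2) (bmulgg H2) mulg1.
- by move=> y /AM My; rewrite asboolT.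
- by rewrite asboolF.
Qed.

Definition open_kernel (a : H -> bool) := nbhs (1 : H) [set y | a y = false].

Lemma bool_hom_near a x : bool_hom a -> open_kernel a ->
  nbhs x [set y | a y = a x].
Proof.
move=> ha oa; apply/nbhs_mulgl; apply: filterS oa => y /= ay.
by rewrite ha ay addbF.
Qed.

(** * Coordinates on a compact open subgroup *)

Section Coordinates.
Variables (K : set H) (c : nat -> H -> bool).
Hypothesis (gK : subgrp K) (cK : compact K) (nK : nbhs 1 K).
Hypothesis c_hom : forall m, bool_hom (c m).
Hypothesis c_open : forall m, open_kernel (c m).
Hypothesis c_sep : forall x, x <> 1 -> exists m, c m x.

(* The positions at which the greedy algorithm extracts a basis from the
   restrictions of c_0, c_1, ... to K. *)
Definition essential : set nat :=
  [set m | exists y, [/\ K y, c m y & forall l, l < m -> c l y = false]].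

(** At the least m with c_m(x) nonzero, x itself would witness that m is essential. *)
Lemma essential_eq0 x : K x ->
  (forall m, essential m -> c m x = false) -> forall m, c m x = false.
Proof.
move=> Kx cx; elim/ltn_ind => m IH; apply/negP => cmx.
by have := cmx; rewrite cx//; exists x.
Qed.

Lemma essential_inj x : K x ->
  (forall m, essential m -> c m x = false) -> x = 1.
Proof.
move=> Kx /(essential_eq0 Kx) cx; apply: contrapT => /c_sep[m].
by rewrite cx.
Qed.

(** Finitely many values are attained step by step: the witness y for an essential n corrects the
    n-th value without changing the earlier ones. Compactness of K then provides one point for all
    values. *)
Lemma essential_surj (u : nat -> bool) :
  exists2 x, K x & forall m, essential m -> c m x = u m.
Proof.
pose Z n := [set x | K x /\ forall m, m < n -> essential m -> c m x = u m].
have Z_ex n : exists x, Z n x.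
  elim: n => [|n [x [Kx cx]]]; first by exists 1; split=> //; exact: gK.1.
  have [[y [Ky cny cy]]|nSn] := pselect (essential n); last first.
    exists x; split=> // m; rewrite ltnS leq_eqVlt => /predU1P[->//|]; exact: cx.
  have [cnx|/eqP cnx] := eqVneq (c n x) (u n).
    exists x; split=> // m; rewrite ltnS leq_eqVlt => /predU1P[->//|]; exact: cx.
  exists (x * y); split; first exact: gK.2.
  move=> m; rewrite ltnS leq_eqVlt => /predU1P[-> _|mn Sm]; rewrite c_hom.
    by rewrite cny; move: cnx; case: (c n x) (u n) => [] [].
  by rewrite cy// addbF cx.
have Z_sub m n : m <= n -> Z n `<=` Z m.
  by move=> mn x [Kx cx]; split=> // l lm; apply: cx; exact: leq_trans mn.
pose F := filter_from setT Z.
have FF : ProperFilter F.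
  apply: filter_from_proper; last by move=> n _; have [x] := Z_ex n; exists x.
  apply: filter_from_filter; first by exists 0.
  move=> m n _ _; exists (maxn m n) => // x Zx.
  by split; apply: Z_sub Zx; rewrite ?leq_maxl ?leq_maxr.
have [|x [Kx clx]] := cK (F := F) FF; first by exists 0 => // x [].
exists x => // m Sm; have := bool_hom_near x (c_hom m) (c_open m).
move=> /(clx (Z m.+1)) [|y [[Ky cy] <-]]; first by exists m.+1.
exact: cy.
Qed.

(** Each point of the compact set K minus the interior of U is detected by some c_m, so finitely
    many c_m detect all of them. Among the first n, the essential ones decide, again by looking at
    the least nonzero value. *)
Lemma essential_nbhs U : nbhs 1 U -> exists n,
  forall x, K x -> (forall m, m < n -> essential m -> c m x = false) -> U x.
Proof.
move=> nU; have cKU : compact (K `\` U^°).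
  apply: (subclosed_compact _ cK); last by move=> x [].
  apply: closedI; first exact: (subgrp_closed H2).
  by apply: open_closedC; exact: open_interior.
have /compact_near_coveringP := cKU.
move=> /(_ nat \oo (fun n x => exists2 m, m < n & c m x) _) [|n _ nP].
  move=> x [Kx Ux]; have [m cm] : exists m, c m x.
    by apply: c_sep => x1; apply: Ux; rewrite x1.
  exists ([set y | c m y = c m x], [set n | m < n]); last first.
    by move=> [y n] [/= cy mn]; exists m; rewrite ?cy.
  split; first exact: bool_hom_near.
  by exists m.+1.
exists n => x Kx cx; apply: contrapT => Ux.
have [||m mn cm] := nP n _ x; first exact: leqnn.
  by split=> // /interior_subset.
have : forall m, m < n -> c m x = false; last by move=> /(_ m mn); rewrite cm.
elim/ltn_ind => l IH ln; apply/negP => clx.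
have := clx; rewrite cx//; exists x; split=> // i il.
by apply: IH => //; exact: ltn_trans ln.
Qed.

End Coordinates.

(** * Coordinates on the discrete quotient by an open subgroup *)

Section DiscreteCoordinates.
Variables (K : set H) (d : nat -> H).
Hypothesis (gK : subgrp K) (nK : nbhs 1 K).
Hypothesis d_dense : forall (x : H) (U : set H), nbhs x U -> exists j, U (d j).

(** The cosets of these d_j form a basis of H/K over Z/2, selected greedily. *)
Definition jumps : set nat := [set j | ~ chain d K j (d j)].

Lemma chain_exhaust x : exists n, chain d K n x.
Proof.
have [|j /= Kj] := @d_dense x [set y | K (x * y)].
  by apply/nbhs_mulgl; apply: filterS nK => y; rewrite /= bmulgK.
exists j.+1 => /=; right; apply: (@chain_sub H d K 0 j) => //=.
by rewrite (bmulgC H2).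
Qed.

(* The system (b_j) is only triangular with respect to (d_j), not dual to it:
   b_j may be nonzero at d_i for i > j. *)
Lemma jump_hom_ex : exists b : nat -> H -> bool,
  [/\ forall j, bool_hom (b j), forall j x, chain d K j x -> b j x = false
    & forall j, jumps j -> b j (d j)].
Proof.
have /choice[b bP] : forall j, exists a, [/\ bool_hom a,
    forall x, chain d K j x -> a x = false & jumps j -> a (d j)].
  move=> j; have [jj|nj] := pselect (jumps j); last first.
    by exists (fun=> false); split.
  have [a [ha a0 aj]] := separating_bool_hom (chain_subgrp H2 d j gK) jj.
  by exists a; split.
by exists b; split=> j; have [] := bP j.
Qed.

Variable b : nat -> H -> bool.
Hypothesis b_hom : forall j, bool_hom (b j).
Hypothesis b_chain : forall j x, chain d K j x -> b j x = false.
Hypothesis b_jump : forall j, jumps j -> b j (d j).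

Lemma jump_chain j n x : n <= j -> chain d K n x -> b j x = false.
Proof. by move=> nj /(chain_sub nj) /b_chain. Qed.

(** If x joins the chain at step n, then n is a jump and b_n(x) = b_n(d_n) is nonzero. *)
Lemma jump_inj x : (forall j, jumps j -> b j x = false) -> K x.
Proof.
move=> bx; have [n] := chain_exhaust x.
elim: n => // n IH /= [//|dx]; have [//|nx] := pselect (chain d K n x).
have jn : jumps n.
  move=> dn; apply: nx.
  exact: (subgrp_mull H2 (chain_subgrp H2 d n gK) dn).
by have := b_chain dx; rewrite b_hom bx// b_jump.
Qed.

(** The triangular system is solved from the top: d_n provides the n-th value, and its effect on the
    lower ones is compensated in advance by the induction hypothesis. *)
Lemma jump_surj n (v : nat -> bool) : exists2 x, chain d K n x &
  forall j, j < n -> jumps j -> b j x = v j.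
Proof.
elim: n v => [|n IH] v; first by exists 1; [exact: gK.1|].
have [[jn vn]|njv] := pselect (jumps n /\ v n).
  have [x nx bx] := IH (fun j => v j (+) b j (d n)).
  exists (d n * x); first by right; rewrite bmulgK.
  move=> j; rewrite ltnS leq_eqVlt => /predU1P[-> _|jltn jj]; rewrite b_hom.
    by rewrite b_jump// (b_chain nx) vn.
  by rewrite bx// addbC -addbA addbb addbF.
have [x nx bx] := IH v; exists x; first by left.
move=> j; rewrite ltnS leq_eqVlt => /predU1P[-> jn|]; last exact: bx.
by rewrite (b_chain nx); apply/esym/negP => vn; exact: njv.
Qed.

End DiscreteCoordinates.
End BooleanHom.

(** * Codings by sequences of natural numbers *)

Definition agree T (s : T -> nat -> nat) n (x y : T) :=
  forall i, i < n -> s y i = s x i.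

(* A coding presents T as a closed subspace of the Baire space nat^nat. *)
Record coding (T : topologicalType) (s : T -> nat -> nat) : Prop := Coding {
  coding_nbhs : forall x (A : set T), nbhs x A <-> exists n, agree s n x `<=` A ;
  coding_inj : forall x y, s x =1 s y -> x = y ;
  coding_closed : forall u, (forall n, exists x, forall i, i < n -> s x i = u i) ->
    exists x, s x =1 u }.

Section Coding.
Variables (T : topologicalType) (s : T -> nat -> nat) (cs : coding s).

Lemma agree_leq m n x y : m <= n -> agree s n x y -> agree s m x y.
Proof. by move=> mn xy i im; apply: xy; exact: leq_trans mn. Qed.

Lemma agree_nbhs n x : nbhs x (agree s n x).
Proof. by apply/(coding_nbhs cs); exists n. Qed.

Lemma coding_continuous (U : topologicalType) (s' : U -> nat -> nat)
    (f : T -> U) : coding s' ->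
  (forall x n, exists k, forall y, agree s k x y -> agree s' n (f x) (f y)) ->
  continuous f.
Proof.
move=> cs' fP x A /(coding_nbhs cs')[n nA]; have [k kP] := fP x n.
by apply/(coding_nbhs cs); exists k => y /kP /nA.
Qed.

Lemma coding_separable : T -> separable_space T.
Proof.
(* [f w] is a point whose code begins with the word w, or x0 if there is none. *)
move=> x0; pose f w := xget x0 [set x | mkseq (s x) (size w) = w].
exists (range f).
  by apply: card_le_trans (card_image_le _ _) _; exact: countableP.
move=> O [x Ox] oO; have /(coding_nbhs cs)[n nO] : nbhs x O.
  exact: open_nbhs_nbhs.
exists (f (mkseq (s x) n)); split; last by exists (mkseq (s x) n).
apply: nO; have := @xgetPex _ x0 [set y | mkseq (s y) n = mkseq (s x) n].
move=> /(_ (ex_intro _ x erefl)); rewrite /f size_mkseq; set y := xget _ _.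
by move=> xy i ni; rewrite -(nth_mkseq 0%N (s y) ni) xy nth_mkseq.
Qed.

Lemma coding_zero_dimensional : zero_dimensional T.
Proof.
move=> x y xy; have [i si] : exists i, s x i <> s y i.
  by apply/existsNP => /(coding_inj cs) /eqP; rewrite (negbTE xy).
exists [set z | s z i = s x i]; split => //=; last by move/esym.
split.
  rewrite openE => z zx; apply/(coding_nbhs cs); exists i.+1 => t zt.
  by rewrite /= zt.
by move=> z /(_ _ (agree_nbhs i.+1 z))[t [<- zt]]; rewrite /= zt.
Qed.

Lemma coding_hausdorff : hausdorff_space T.
Proof.
move=> x y xy; apply: (coding_inj cs) => i.
have [z [xz yz]] := xy _ _ (agree_nbhs i.+1 x) (agree_nbhs i.+1 y).
by rewrite -xz// -yz.
Qed.

End Coding.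

(** * The complete metric attached to a coding *)

Section CodingMetric.
Import GRing.Theory Num.Theory Order.TTheory.
Local Open Scope ring_scope.
Variables (R : realType) (T : topologicalType) (s : T -> nat -> nat).
Hypothesis cs : coding s.

(** The usual ultrametric of the Baire space, pulled back along s. *)
Definition code_dist (x y : T) : R :=
  if pselect (exists i, s x i != s y i) is left h then (ex_minn h).+1%:R^-1
  else 0.

Lemma code_distP x y :
  (code_dist x y = 0 /\ s x =1 s y) \/
  (exists m, [/\ code_dist x y = m.+1%:R^-1, s x m != s y m & agree s m x y]).
Proof.
rewrite /code_dist; case: pselect => [h|h]; last first.
  left; split=> // i; apply/eqP; apply: contra_notT h => xy; by exists i.
right; case: ex_minnP => m xym min; exists m; split => // i im.
by apply/esym/eqP; rewrite -[_ == _]negbK; apply/negP => /min; rewrite leqNgt im.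
Qed.

Lemma code_dist_lt x y n :
  code_dist x y < n.+1%:R^-1 <-> agree s n.+1 x y.
Proof.
have [[-> xy]|[m [-> xym xy]]] := code_distP x y.
  by rewrite invr_gt0 ltr0n; split=> // _ i _.
rewrite ltf_pV2 ?posrE ?ltr0n// ltr_nat ltnS.
split=> [nm|nxy]; first exact: agree_leq xy.
by rewrite ltnNge; apply/negP => mn; rewrite nxy ?eqxx in xym.
Qed.

Lemma code_dist_ge0 x y : 0 <= code_dist x y.
Proof.
by have [[-> _]|[m [-> _ _]]] := code_distP x y; rewrite // invr_ge0.
Qed.

Lemma code_distxx x : code_dist x x = 0.
Proof. by have [[]|[m []]] := code_distP x x; rewrite ?eqxx. Qed.

Lemma code_dist_sym x y : code_dist x y = code_dist y x.
Proof.
have leD x' y' : code_dist x' y' <= code_dist y' x'.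
  have [[-> _]|[m [e xym _]]] := code_distP x' y'; first exact: code_dist_ge0.
  rewrite e leNgt; apply/negP => /code_dist_lt yx.
  by rewrite (yx m) ?eqxx in xym.
by apply/eqP; rewrite eq_le !leD.
Qed.

(** At the first index where the codes of x and z differ, the code of y differs from one of them, so
    that one summand is already as large as the left side. *)
Lemma code_dist_triangle y x z :
  code_dist x z <= code_dist x y + code_dist y z.
Proof.
have [[-> _]|[m [e xzm _]]] := code_distP x z.
  by rewrite addr_ge0 ?code_dist_ge0.
have [xym|xym] := eqVneq (s x m) (s y m).
  apply: ler_wpDl; first exact: code_dist_ge0.
  rewrite e leNgt; apply/negP => /code_dist_lt yz.
  by rewrite xym (yz m) ?eqxx in xzm.
apply: ler_wpDr; first exact: code_dist_ge0.
rewrite e leNgt; apply/negP => /code_dist_lt xy.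
by rewrite (xy m) ?eqxx in xym.
Qed.

Lemma code_dist_eq0 x y : code_dist x y = 0 -> x = y.
Proof.
have [[_ /(coding_inj cs)//]|[m [-> _ _]]] := code_distP x y.
by move/eqP; rewrite invr_eq0 pnatr_eq0.
Qed.

End CodingMetric.

(* An alias of T, to carry the metric attached to the coding s. *)
Definition coded (R : realType) (T : topologicalType) (s : T -> nat -> nat)
  (cs : coding s) : Type := T.

HB.instance Definition _ R T s cs := Choice.on (@coded R T s cs).
HB.instance Definition _ (R : realType) T s cs :=
  isMetric.Build R (@coded R T s cs) (@code_distxx R T s)
    (@code_dist_eq0 R T s cs) (@code_dist_sym R T s) (@code_dist_triangle R T s).

Section CodingPolish.
Import GRing.Theory Num.Theory Order.TTheory.
Local Open Scope ring_scope.
Variables (R : realType) (T : topologicalType) (s : T -> nat -> nat).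
Hypothesis cs : coding s.

Local Notation M := (coded R cs).

Lemma coded_ball (x : M) n : ball x n.+1%:R^-1 = agree s n.+1 x :> set M.
Proof.
rewrite ballEmdist; apply/seteqP.
split=> y; rewrite /= /mdist/= => h.
  exact: (iffLR (code_dist_lt _ _ _ _ _) h).
exact: (iffRL (code_dist_lt _ _ _ _ _) h).
Qed.

Lemma coded_nbhs (x : M) (A : set M) : nbhs x A <-> nbhs (x : T) (A : set T).
Proof.
rewrite (coding_nbhs cs); split=> [/nbhs_ballP[e /= e0 eA]|[n nA]].
  have [n] := ltr_add_invr e0; rewrite add0r => ne; exists n.+1.
  by rewrite -coded_ball; apply: subset_trans eA; apply: le_ball; exact: ltW.
apply/nbhs_ballP; exists n.+1%:R^-1; first by rewrite /= invr_gt0.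
by rewrite coded_ball; apply: subset_trans nA => y; exact: agree_leq.
Qed.

Lemma coding_completely_metrizable : completely_metrizable R T.
Proof.
exists M; split=> [F FF /cauchyP cF|].
  have /choice[x xF] : forall n, exists x : M, F (ball x n.+1%:R^-1).
    by move=> n; apply: cF; rewrite invr_gt0.
  have xE m n : (m <= n)%N -> s (x m) m = s (x n) m.
    move=> mn; have := filter_ex (filterI (xF m) (xF n)).
    by move=> [y []]; rewrite !coded_ball => <-// <-.
  (* The limit has the diagonal sequence as its code, since x_m and x_n have the same entry at index
     m whenever m <= n. *)
  have [|y yE] := coding_closed cs (u := fun n => s (x n) n).
    by move=> n; exists (x n) => i /ltnW /xE.
  exists y => A /coded_nbhs/(coding_nbhs cs)[n nA].
  apply: filterS (xF n); rewrite coded_ball => z xz; apply: nA => i ltin.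
  have zi : s z i = s (x n) i by apply: xz; exact: ltnW.
  by rewrite zi -(xE _ _ (ltnW ltin)); exact: esym (yE i).
exists id, id; split=> // x A nA; first exact: (iffLR (coded_nbhs _ _) nA).
exact: (iffRL (coded_nbhs _ _) nA).
Qed.

Lemma coding_polish : T -> polish R T.
Proof.
by move=> x; split; [exact: coding_separable cs x|exact: coding_completely_metrizable].
Qed.

End CodingPolish.

(** * Codings of discrete spaces, products and powers of {0, 1} *)

Definition cantor_code (I : countType) (u : I -> bool) (k : nat) : nat :=
  if pickle_inv k is Some i then u i else false.

(** Both codes are packed into the same entry, so that agreement up to n is agreement of both
    components up to n. *)
Definition pair_code T U (s : T -> nat -> nat) (r : U -> nat -> nat)
  (x : T * U) (k : nat) : nat := pickle (s x.1 k, r x.2 k).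

Lemma principal_coding (T : topologicalType) (code : T -> nat) :
  injective code -> (forall A : set T, open A) -> coding (fun x _ => code x).
Proof.
move=> code_inj opT; split.
- move=> x A; split=> [xA|[n nA]].
    by exists 1%N => y /(_ 0%N erefl) /code_inj ->; exact: nbhs_singleton.
  apply: open_nbhs_nbhs; split; first exact: opT.
  exact: nA.
- by move=> x y /(_ 0%N) /code_inj.
- move=> u uP; have [x ux] := uP 1%N; exists x => n.
  have [y uy] := uP n.+1.
  by rewrite (ux 0%N isT) -(uy 0%N isT); exact: (uy n (leqnn _)).
Qed.

Lemma bool_coding : coding (fun (b : bool) _ => pickle b).
Proof.
apply: principal_coding; last exact: discrete_open.
exact: (pcan_inj pickleK).
Qed.

Lemma agree_pair T U (s : T -> nat -> nat) (r : U -> nat -> nat) n p q :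
  agree (pair_code s r) n p q <-> agree s n p.1 q.1 /\ agree r n p.2 q.2.
Proof.
split=> [pq|[pq1 pq2] i ni]; last by rewrite /pair_code pq1// pq2.
by split=> i ni; have /(pcan_inj pickleK)[] := pq i ni.
Qed.

Lemma pair_coding (T U : topologicalType) s r :
  @coding T s -> @coding U r -> coding (pair_code s r).
Proof.
move=> cs cr.
split.
- move=> [x y] A; split=> [[[V W] [/= nV nW] VWA]|[n nA]].
    have [m mV] := iffLR (coding_nbhs cs _ _) nV.
    have [n nW'] := iffLR (coding_nbhs cr _ _) nW.
    exists (maxn m n) => -[z t] /agree_pair[/= xz yt]; apply: VWA; split=> /=.
      by apply: mV; apply: agree_leq xz; rewrite leq_maxl.
    by apply: nW'; apply: agree_leq yt; rewrite leq_maxr.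
  exists (agree s n x, agree r n y); first by split; exact: agree_nbhs.
  by move=> [z t] [/= xz yt]; apply: nA; apply/agree_pair.
- move=> [x y] [z t] e; congr pair.
    apply: (coding_inj cs) => i.
    by have /(pcan_inj pickleK)[] := e i.
  apply: (coding_inj cr) => i.
  by have /(pcan_inj pickleK)[] := e i.
- move=> u uP; pose v i := odflt (0, 0)%N (unpickle (u i)).
  have vE n (p : T * U) : (forall i, (i < n)%N -> pair_code s r p i = u i) ->
      forall i, (i < n)%N -> s p.1 i = (v i).1 /\ r p.2 i = (v i).2.
    by move=> pu i ni; rewrite /v -pu// /pair_code pickleK.
  have [|x xE] := coding_closed cs (u := fst \o v).
    by move=> n; have [p /vE pE] := uP n; exists p.1 => i /pE[].
  have [|y yE] := coding_closed cr (u := snd \o v).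
    by move=> n; have [p /vE pE] := uP n; exists p.2 => i /pE[].
  exists (x, y) => i; rewrite /pair_code xE yE /= /v.
  by have [p <-//] := uP i.+1; rewrite /pair_code pickleK.
Qed.

(** The first n entries concern finitely many coordinates, and coordinate i is read at entry
    [pickle i]; so cylinders and neighbourhoods in the product refine each other. *)
Lemma cantor_coding (I : countType) :
  @coding (prod_topology (fun _ : I => bool)) (@cantor_code I).
Proof.
have agreeE n (u v : I -> bool) : agree (@cantor_code I) n u v <->
    forall i, (pickle i < n)%N -> v i = u i.
  split=> [uv i /uv|uv k kn]; rewrite /cantor_code.
    by rewrite pickleK_inv; case: (u i) (v i) => [] [].
  case: (pickle_inv k) (@pickle_invK I k) => //= i ik.
  by rewrite uv// ik.
pose X : topologicalType := prod_topology (fun _ : I => bool).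
have near_agree n (u : X) : nbhs u (agree (@cantor_code I) n u).
  have : nbhs u [set v : X | forall k : 'I_n, cantor_code v k = cantor_code u k].
    pose P (k : 'I_n) : set X := [set v | cantor_code v k = cantor_code u k].
    have := @filter_forall X 'I_n P (nbhs u) (@nbhs_filter X u). apply => k.
    rewrite /P /cantor_code.
    case: (pickle_inv k) => [i|]; last exact: filterE.
    have ui : nbhs u (proj i @^-1` [set u i]).
      by apply: (@proj_continuous I (fun=> bool)); exact: discrete_set1.
    by apply: (filterS _ ui) => v /= <-.
  by move=> nP; apply: (filterS _ nP) => v uv i ni; exact: (uv (Ordinal ni)).
split.
- move=> u A; split=> [uA|[n nA]]; last exact: (filterS nA (near_agree n u)).
  pose F := filter_from setT (fun n => agree (@cantor_code I) n u).
  have FF : Filter F.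
    apply: filter_from_filter; first by exists 0%N.
    move=> m n _ _; exists (maxn m n) => // v uv.
    by split; apply: agree_leq uv; rewrite ?leq_maxl ?leq_maxr.
  suff Fu : F --> (u : X).
    by have [n _ nA] := Fu _ uA; exists n.
  apply/cvg_sup => i U [V [[W] oW <-] Wu WU].
  exists (pickle i).+1 => // v /agreeE uv; apply: WU.
  by rewrite /= uv.
- move=> u v uv; apply/funext => i; have := uv (pickle i).
  by rewrite /cantor_code pickleK_inv; case: (u i) (v i) => [] [].
- move=> w wP; pose u (i : I) := w (pickle i) != 0%N; exists u => k.
  have [v /(_ k (leqnn _))] := wP k.+1; rewrite /cantor_code.
  case: (pickle_inv k) (@pickle_invK I k) => //= i ik.
  by rewrite /u ik => <-; case: (v i).
Qed.

(* The group Z/2 x (Z/2)^I x (Z/2)^(J): an element of the direct sum is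
   represented by its finite support, so that addition is the symmetric
   difference. *)
Definition model (I : countType) (J : countType) : Type :=
  (bool * prod_topology (fun _ : I => bool) * discrete_topology {fset J})%type.

HB.instance Definition _ I J := Topological.copy (model I J)
  (bool * prod_topology (fun _ : I => bool) * discrete_topology {fset J})%type.

(** * The models as topological groups and base pairs *)

Section Model.
Variables I J : countType.
Implicit Types m : model I J.

Definition fsymdiff (A B : {fset J}) : {fset J} :=
  [fset j in (A `|` B)%fset | (j \in A) (+) (j \in B)]%fset.

Lemma in_fsymdiff A B j : (j \in fsymdiff A B) = (j \in A) (+) (j \in B).
Proof. by rewrite !inE; case: (j \in A) (j \in B) => [] []. Qed.

Definition model_mul m m' : model I J :=
  ((m.1.1 (+) m'.1.1, fun i => m.1.2 i (+) m'.1.2 i), fsymdiff m.2 m'.2).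

Definition model_one : model I J := ((false, fun=> false), fset0).

Lemma model_eqP m m' : m.1.1 = m'.1.1 -> m.1.2 =1 m'.1.2 -> m.2 =i m'.2 ->
  m = m'.
Proof.
case: m m' => [[b u] A] [[b' u'] A'] /= -> /funext -> AA'.
by congr pair; apply/fsetP.
Qed.

Lemma model_mulA : associative model_mul.
Proof.
move=> m1 m2 m3; apply: model_eqP => /= [|i|j]; rewrite ?addbA//.
by rewrite !in_fsymdiff addbA.
Qed.

Lemma model_mul1 : left_id model_one model_mul.
Proof. by move=> m; apply: model_eqP => //= j; rewrite in_fsymdiff. Qed.

Lemma model_1mul : right_id model_one model_mul.
Proof.
by move=> m; apply: model_eqP => /= [|i|j]; rewrite ?in_fsymdiff ?in_fset0 addbF.
Qed.

Lemma model_mulV : left_inverse model_one id model_mul.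
Proof.
by move=> m; apply: model_eqP => /= [|i|j]; rewrite ?in_fsymdiff addbb.
Qed.

HB.instance Definition _ := isGroup.Build (model I J)
  model_mulA model_mul1 model_1mul model_mulV model_mulV.

Definition model_code : model I J -> nat -> nat :=
  pair_code (pair_code (fun b _ => pickle b) (@cantor_code I))
    (fun A _ => pickle (A : {fset J})).

Lemma model_coding : coding model_code.
Proof.
apply: pair_coding; first apply: pair_coding.
- exact: bool_coding.
- exact: cantor_coding.
- apply: principal_coding; last exact: discrete_open.
  exact: (pcan_inj pickleK).
Qed.

Lemma model_mul_continuous :
  continuous (fun mm : model I J * model I J => mm.1 * mm.2).
Proof.
apply: (coding_continuous (pair_coding model_coding model_coding) model_coding).
move=> [m1 m2] n; exists n => -[m3 m4].
move=> /agree_pair[/agree_pair[/agree_pair[b1 u1] A1]].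
move=> /agree_pair[/agree_pair[b2 u2] A2].
apply/agree_pair; split; first (apply/agree_pair; split) => i ni /=.
- have /(pcan_inj pickleK)/= -> := b1 i ni.
  by have /(pcan_inj pickleK)/= -> := b2 i ni.
- have := u1 i ni; have := u2 i ni; rewrite /= /cantor_code.
  by case: (pickle_inv i) => // j; do 4!case: (_ j).
- move=> i ni; have /(pcan_inj pickleK)/= -> := A1 i ni.
  by have /(pcan_inj pickleK)/= -> := A2 i ni.
Qed.

Lemma model_inv_continuous : continuous (fun m : model I J => m^-1).
Proof. by move=> m; exact: cvg_id. Qed.

HB.instance Definition _ := PreTopologicalGroup_isTopologicalGroup.Build
  (model I J) model_mul_continuous model_inv_continuous.

Lemma model_boolean : boolean_group (model I J).
Proof. exact: model_mulV. Qed.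

Definition model_point : model I J := ((true, fun=> false), fset0).

Lemma model_point_neq1 : model_point <> 1. Proof. by []. Qed.

Definition model_base : basePair := BasePair (bmulgC model_boolean)
  (model_boolean model_point) model_point_neq1.

Definition iso_model : topologicalGroupType :=
  base_prod (tilde_base (model_boolean : boolean_group model_base)).

Lemma iso_model_iso_singular : iso_singular iso_model.
Proof.
exists model_base, model_boolean, id => //.
by exists id; split=> // x; exact: cvg_id.
Qed.

Definition iso_model_code : iso_model -> nat -> nat :=
  pair_code (pair_code model_code (fun b _ => pickle b)) (fun b _ => pickle b).

Lemma iso_model_coding : coding iso_model_code.
Proof.
by apply: pair_coding; [apply: pair_coding; [exact: model_coding|]|];
  exact: bool_coding.
Qed.

(** Tychonoff's theorem handles the power of Z/2. A singleton F leads to local compactness; for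
    finite J, F may consist of all supports. *)
Lemma model_compact_set (F : set {fset J}) : finite_set F ->
  compact [set m : model I J | F m.2].
Proof.
move=> finF; rewrite (_ : [set m | _] =
    [set: bool] `*` [set: {ptws I -> bool}] `*` F).
  apply: compact_setX; last exact: (@finite_compact (discrete_topology {fset J})).
  apply: compact_setX; first exact: bool_compact.
  have := @tychonoff I (fun=> bool) (fun=> [set: bool]) (fun=> bool_compact).
  by congr compact; apply/seteqP.
by apply/seteqP; split=> [m|m []].
Qed.

Lemma iso_model_compact_set (F : set {fset J}) : finite_set F ->
  compact [set g : iso_model | F g.1.1.2].
Proof.
move=> /model_compact_set cF.
rewrite (_ : [set g | _] =
    [set m : model I J | F m.2] `*` [set: bool] `*` [set: bool]).
  by apply: compact_setX; [apply: compact_setX => //|]; exact: bool_compact.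
by apply/seteqP; split=> [g|g [[]]].
Qed.

Lemma iso_model_locally_compact : locally_compact [set: iso_model].
Proof.
move=> g _; exists [set h : iso_model | h.1.1.2 = g.1.1.2].
  rewrite withinET.
  apply/(coding_nbhs iso_model_coding); exists 1%N => h.
  move=> /agree_pair[/agree_pair[/agree_pair[_ A] _] _].
  exact: (pcan_inj pickleK (A 0%N isT)).
have cg : compact [set h : iso_model | h.1.1.2 = g.1.1.2].
  exact: (@iso_model_compact_set [set g.1.1.2]).
split=> //; apply: compact_closed => //.
exact: coding_hausdorff iso_model_coding.
Qed.

Lemma iso_model_lcp (R : realType) : lcp_iso_singular R iso_model.
Proof.
split; [exact: iso_model_locally_compact| |exact: iso_model_iso_singular].
exact: (coding_polish R iso_model_coding (1 : iso_model)).
Qed.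

End Model.

(** * Invariance under isomorphism *)

Lemma homeomorphism_sym (T U : topologicalType) (f : T -> U) :
  homeomorphism f -> exists2 g, homeomorphism g & cancel f g /\ cancel g f.
Proof. by move=> [g [fK gK cf cg]]; exists g => //; exists f. Qed.

Lemma topgroup_isomorphic_sym G H :
  topgroup_isomorphic G H -> topgroup_isomorphic H G.
Proof.
move=> [f fM /homeomorphism_sym[g hg [fK gK]]]; exists g => // x y.
by apply: (can_inj fK); rewrite fM !gK.
Qed.

Lemma topgroup_isomorphic_trans G H L : topgroup_isomorphic G H ->
  topgroup_isomorphic H L -> topgroup_isomorphic G L.
Proof.
move=> [f fM [f' [fK f'K cf cf']]] [g gM [g' [gK g'K cg cg']]].
exists (g \o f); first by move=> x y /=; rewrite fM gM.
exists (f' \o g'); split.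
- exact: can_comp.
- exact: can_comp.
- by move=> x; apply: continuous_comp; [exact: cf|exact: cg].
- by move=> x; apply: continuous_comp; [exact: cg'|exact: cf'].
Qed.

Lemma homeomorphism_compact (T U : topologicalType) (f : T -> U) :
  homeomorphism f -> compact [set: T] -> compact [set: U].
Proof.
move=> [g [fK gK cf cg]] cT; rewrite (_ : [set: U] = f @` [set: T]).
  by apply: continuous_compact => //; exact: continuous_subspaceT.
by apply/seteqP; split=> // u _; exists (g u).
Qed.

Lemma homeomorphism_discrete (T U : topologicalType) (f : T -> U) :
  homeomorphism f -> discrete_space T -> discrete_space U.
Proof.
move=> [g [fK gK cf cg]] dT A; rewrite (_ : A = g @^-1` (g @` A)).
  by apply: open_comp; [move=> x _; exact: cg|exact: dT].
by apply/seteqP; split=> [u Au|u [v Av /(can_inj gK) <-]]; first by exists u.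
Qed.

Lemma inj_infinite_set (T U : Type) (f : T -> U) :
  injective f -> infinite_set [set: T] -> infinite_set [set: U].
Proof.
move=> f_inj; apply: contra_not => finU.
have := @finite_preimage _ _ [set: U] f (in2W f_inj) finU.
by rewrite preimage_setT.
Qed.

Lemma coding_discrete (T : topologicalType) (s : T -> nat -> nat) :
  coding s -> (forall x, exists n, agree s n x `<=` [set x]) ->
  discrete_space T.
Proof.
move=> cs sP A; rewrite openE => x Ax; have [n nx] := sP x.
by apply/(coding_nbhs cs); exists n => y /nx ->.
Qed.

(** * Compactness, discreteness and infinitude of the models *)

Section ModelProperties.
Variables (I J : countType) (n : nat).

Lemma model_agree_finite : exists k, forall m : model 'I_n J,
  agree (@model_code 'I_n J) k m `<=` [set m].
Proof.
(* The bound on the positions [pickle i] is raised by one so that entry 0, which reveals the other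
   two components, is compared also for n = 0. *)
exists (\max_(i < n) (pickle i).+1).+1 => m m'.
move=> /agree_pair[/agree_pair[b u] A]; apply: model_eqP => [|i|j].
- exact: (pcan_inj pickleK (b 0%N isT)).
- have := u (pickle i); rewrite /cantor_code pickleK_inv ltnS.
  have /ltnW -> : (pickle i < \max_(i < n) (pickle i).+1)%N.
    exact: (@leq_bigmax _ (fun i : 'I_n => (pickle i).+1) i).
  by move=> /(_ isT); case: (m'.1.2 i) (m.1.2 i) => [] [].
- by rewrite (pcan_inj pickleK (A 0%N isT)).
Qed.

Lemma model_discrete : discrete_space (model 'I_n J).
Proof.
have [k kP] := model_agree_finite.
by apply: (coding_discrete (@model_coding _ _)) => m; exists k; exact: kP.
Qed.

Lemma iso_model_discrete : discrete_space (iso_model 'I_n J).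
Proof.
have [k kP] := model_agree_finite.
apply: (coding_discrete (@iso_model_coding _ _)) => -[[m b] c].
exists k.+1 => -[[m' b'] c'].
move=> /agree_pair[/agree_pair[/(agree_leq (leqnSn _))/kP/= -> bb'] cc'].
have /(pcan_inj pickleK)/= -> := bb' 0%N isT.
by have /(pcan_inj pickleK)/= -> := cc' 0%N isT.
Qed.

(** The indicator of {k} agrees with the neutral element in the first k entries, so that no cylinder
    around the latter is a singleton. *)
Lemma iso_model_not_discrete : ~ discrete_space (iso_model nat J).
Proof.
move=> /(_ [set 1]) o1.
have /(coding_nbhs (@iso_model_coding nat J))[k kP] :
  nbhs (1 : iso_model nat J) [set 1] by exact: open_nbhs_nbhs.
have /kP : agree (@iso_model_code nat J) k 1
    (((false, fun i => i == k), fset0), false, false).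
  apply/agree_pair; split=> //; apply/agree_pair; split=> //.
  apply/agree_pair; split=> //; apply/agree_pair; split=> // i ik.
  rewrite /cantor_code /=; case: (pickle_inv i) (@pickle_invK nat i) => //= j.
  by move=> ji; case: eqP => // jk; rewrite -ji jk ltnn in ik.
by case=> /(congr1 (@^~ k)); rewrite eqxx.
Qed.

Lemma model_compact : compact [set: model I 'I_n].
Proof.
have := @model_compact_set I 'I_n setT finite_finset.
by congr compact; apply/seteqP.
Qed.

Lemma iso_model_compact : compact [set: iso_model I 'I_n].
Proof.
have := @iso_model_compact_set I 'I_n setT finite_finset.
by congr compact; apply/seteqP.
Qed.

(** Compactness would bound all supports by a single k, which the support {k} violates. *)
Lemma iso_model_not_compact : ~ compact [set: iso_model I nat].
Proof.
move=> /compact_near_coveringP.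
move=> /(_ nat \oo (fun k g => forall j, j \in g.1.1.2 -> (j < k)%N) _) [|k _ kP].
  move=> g _.
  exists (agree (@iso_model_code I nat) 1 g,
          [set k | (\max_(j <- g.1.1.2) j.+1 <= k)%N]); last first.
    move=> [h k] [/= /agree_pair[/agree_pair[/agree_pair[_ A] _] _] gk] j.
    rewrite (pcan_inj pickleK (A 0%N isT)) => jg; apply: leq_trans gk.
    by rewrite (big_rem j jg)/= leq_maxl.
  split; first exact: (agree_nbhs (@iso_model_coding I nat)).
  by exists (\max_(j <- g.1.1.2) j.+1).
have := kP k (leqnn _)
  (((false, fun=> false), [fset k]%fset), false, false) Logic.I k.
by rewrite inE eqxx ltnn => /(_ isT).
Qed.

Lemma iso_model_infinitel : infinite_set [set: iso_model nat J].
Proof.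
pose f k : iso_model nat J := (((false, fun i => i == k), fset0), false, false).
apply: (@inj_infinite_set _ _ f) infinite_nat => k l [].
by move=> /(congr1 (@^~ k)); rewrite eqxx => /esym/eqP.
Qed.

Lemma iso_model_infiniter : infinite_set [set: iso_model I nat].
Proof.
pose f k : iso_model I nat := (((false, fun=> false), [fset k]%fset), false, false).
by apply: (@inj_infinite_set _ _ f) infinite_nat => k l [] /fset1_inj.
Qed.

End ModelProperties.

(** * Cardinalities of the finite models *)

Lemma fset_ord0 (A B : {fset 'I_0}) : A = B.
Proof. by apply/fsetP => -[]. Qed.

(** This finite type has 2^(n+3) elements, so that the cardinality determines n. *)
Definition fin_model n : finType := (bool * {ffun 'I_n -> bool} * bool * bool)%type.

Definition fin_model_iso n (x : fin_model n) : iso_model 'I_n 'I_0 :=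
  (((x.1.1.1, fun i => x.1.1.2 i), fset0), x.1.2, x.2).

Definition iso_model_fin n (g : iso_model 'I_n 'I_0) : fin_model n :=
  (g.1.1.1.1, [ffun i => g.1.1.1.2 i], g.1.2, g.2).

Lemma fin_model_isoK n : cancel (@fin_model_iso n) (@iso_model_fin n).
Proof.
move=> [[[b u] c] c']; rewrite /iso_model_fin /=; congr (_, _, _, _).
by apply/ffunP => i; rewrite ffunE.
Qed.

Lemma iso_model_finK n : cancel (@iso_model_fin n) (@fin_model_iso n).
Proof.
move=> [[[[b u] A] c] c']; rewrite /fin_model_iso /= (fset_ord0 fset0 A).
by congr (_, _, _, _, _); apply/funext => i; rewrite ffunE.
Qed.

Lemma iso_model_finite n : finite_set [set: iso_model 'I_n 'I_0].
Proof.
have := finite_image (@fin_model_iso n) (@finite_finset _ [set: fin_model n]).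
by congr finite_set; apply/seteqP; split=> // g _; exists (iso_model_fin g);
  rewrite ?iso_model_finK.
Qed.

Lemma card_le_setT (T U : Type) : ([set: T] #<= [set: U])%card ->
  exists f : T -> U, injective f.
Proof.
move=> /card_leP[f]; exists (fun x => val (f (SigSub (mem_setT x)))) => x y.
by move=> /val_inj/(inj (f := f))/= => /(_ (in_setT _) (in_setT _)) [].
Qed.

Lemma iso_model_card_le m n (f : iso_model 'I_m 'I_0 -> iso_model 'I_n 'I_0) :
  injective f -> m <= n.
Proof.
move=> f_inj; have : injective (@iso_model_fin n \o f \o @fin_model_iso m).
  apply: inj_comp; last exact: can_inj (@fin_model_isoK m).
  by apply: inj_comp => //; exact: can_inj (@iso_model_finK n).
move=> /leq_card; rewrite !card_prod !card_ffun !card_ord !card_bool.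
by rewrite !leq_pmul2r// leq_pmul2l// leq_exp2l.
Qed.

(** * Isomorphisms of base pairs *)

Definition base_pair_isomorphic (B B' : basePair) := exists f : B -> B',
  [/\ {morph f : x y / x * y}, homeomorphism f & f (bp_point B) = bp_point B'].

(** The map F is explicit because it has to be seen to respect the marked points when the lemma is
    applied to it in turn. *)
Lemma base_prod_isomorphic (B B' : basePair) (f : B -> B') :
  {morph f : x y / x * y} -> homeomorphism f -> f (bp_point B) = bp_point B' ->
  let F (u : base_prod B) : base_prod B' := (f u.1, u.2) in
  {morph F : x y / x * y} /\ homeomorphism F.
Proof.
move=> fM [g [fK gK cf cg]] fp F; split; last first.
  have cont (C C' : basePair) (h : C -> C') : continuous h ->
      continuous ((fun u => (h u.1, u.2)) : base_prod C -> base_prod C').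
    move=> ch [x j].
    have c1 : {for (x, j) : base_prod C, continuous (fun u : base_prod C => h u.1)}.
      by apply: (@continuous_comp (base_prod C) C C' (fun u => u.1) h);
        [exact: cvg_fst|exact: ch].
    by apply: (@cvg_pair _ _ _ _ (nbhs (h x)) (nbhs j)) => //; exact: cvg_snd.
  exists (fun u => (g u.1, u.2)); split.
  - by move=> [x j]; rewrite /F /= fK.
  - by move=> [x j]; rewrite /F /= gK.
  - exact: cont.
  - exact: cont.
have f1 : f 1 = 1 by apply: (mulgI (f 1)); rewrite -fM !mulg1.
have fV x : f x^-1 = (f x)^-1 by apply: (mulgI (f x)); rewrite -fM !mulgV.
by move=> [x [|]] [y [|]]; rewrite /F /mul/= !fM ?fV ?fp.
Qed.

Lemma base_pair_isomorphic_tilde (B B' : basePair)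
    (B2 : boolean_group B) (B2' : boolean_group B') :
  base_pair_isomorphic B B' ->
  topgroup_isomorphic (base_prod (tilde_base B2)) (base_prod (tilde_base B2')).
Proof.
move=> [f [fM hf fp]]; have [FM hF] := base_prod_isomorphic fM hf fp.
have [|FFM hFF] := @base_prod_isomorphic (tilde_base B2) (tilde_base B2') _ FM hF.
  by rewrite /= /tilde_point/= fp.
by exists (fun u : base_prod (tilde_base B2) => ((f u.1.1, u.1.2), u.2)).
Qed.

(** * Countably many separating homomorphisms *)

Section SeparatingHoms.
Variables (H : topologicalGroupType) (H2 : boolean_group H).
Variables (d : nat -> H) (U : nat -> set H).
Hypothesis d_dense : forall (x : H) (V : set H), nbhs x V -> exists j, V (d j).
Hypothesis U_nbhs : forall n, nbhs 1 (U n).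
Hypothesis U_sep : forall x, (forall n, U n x) -> x = 1.

(** Each d_j outside an open subgroup L_n of U_n gets a homomorphism that vanishes on L_n but not at
    d_j. A point x other than 1 lies outside some U_n, and some d_j in its coset of L_n shares its
    values. *)
Lemma separating_homs (K : set H) : subgrp K -> compact K -> nbhs 1 K ->
  exists c : nat -> H -> bool, [/\ forall m, bool_hom (c m),
    forall m, open_kernel (c m) & forall x, x <> 1 -> exists m, c m x].
Proof.
move=> gK cK nK.
have /choice[L LP] : forall n, exists L, [/\ subgrp L, nbhs 1 L & L `<=` U n].
  by move=> n; exact: (small_open_subgroup H2 d_dense gK cK nK).
have /choice[a aP] : forall q : nat * nat, exists a : H -> bool,
    [/\ bool_hom a, open_kernel a & ~ L q.1 (d q.2) ->
      (forall y, L q.1 y -> a y = false) /\ a (d q.2)].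
  move=> [n j] /=; have [gL nL _] := LP n.
  have [Lj|nLj] := pselect (L n (d j)).
    by exists (fun=> false); split=> //; exact: filterE.
  have [a [ha La aj]] := separating_bool_hom H2 gL nLj.
  by exists a; split=> //; apply: filterS nL => y /La.
exists (fun m x => if unpickle m is Some q then a q x else false); split.
- by move=> m; case: unpickle => // q; have [] := aP q.
- by move=> m; case: unpickle => [q|]; [have [] := aP q|exact: filterE].
move=> x x1; have [n nUx] : exists n, ~ U n x.
  by apply/existsNP => /U_sep.
have [gL nL LU] := LP n.
have [|j /= Lxj] := @d_dense x [set y | L n (x * y)].
  by apply/nbhs_mulgl; apply: filterS nL => y; rewrite /= bmulgK.
have nLj : ~ L n (d j).
  move=> Lj; apply: nUx; apply: LU; apply: (subgrp_mull H2 gL Lj).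
  by rewrite (bmulgC H2).
have [ha _ /(_ nLj)[La aj]] := aP (n, j).
exists (pickle (n, j)); rewrite pickleK.
have := La _ Lxj; rewrite ha; move: aj => /= ->.
by case: (a _ x).
Qed.

(** A change of basis: some c_q with c_q(p) = 1 is put first and added to each c_l with c_l(p) = 1.
    Where c_q vanishes, the values of the c_l are unchanged, so separation persists. *)
Lemma adapted_homs (K : set H) p : subgrp K -> compact K -> nbhs 1 K -> p <> 1 ->
  exists c : nat -> H -> bool, [/\ forall m, bool_hom (c m),
    forall m, open_kernel (c m), forall x, x <> 1 -> exists m, c m x,
    c 0%N p & forall m, c m.+1 p = false].
Proof.
move=> gK cK nK p1; have [c [hc oc sc]] := separating_homs gK cK nK.
have [q cqp] := sc _ p1.
pose c' m x := if m is l.+1 then c l x (+) (c l p && c q x) else c q x.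
exists c'; split=> //.
- case=> [|m] x y /=; first exact: hc.
  by rewrite !hc; case: (c m p) => /=; rewrite ?addbF// addbACA.
- case=> [|m]; first exact: oc.
  apply: filterS2 (oc m) (oc q) => x /= cm cq.
  by rewrite /c' cm cq andbF.
- move=> x /sc[m cmx]; have [cqx|/negbTE ncqx] := boolP (c q x).
    by exists 0%N.
  by exists m.+1; rewrite /= ncqx andbF addbF.
by move=> m /=; rewrite cqp andbT addbb.
Qed.

End SeparatingHoms.

(** * The isomorphism with a model *)

Section CoordinateIsomorphism.
Variables (H : topologicalGroupType) (H2 : boolean_group H) (p : H).
Variables (d : nat -> H) (K : set H) (c : nat -> H -> bool).
Hypothesis d_dense : forall (x : H) (V : set H), nbhs x V -> exists j, V (d j).
Hypotheses (gK : subgrp K) (cK : compact K) (nK : nbhs 1 K) (Kp : K p).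
Hypothesis c_hom : forall m, bool_hom (c m).
Hypothesis c_open : forall m, open_kernel (c m).
Hypothesis c_sep : forall x, x <> 1 -> exists m, c m x.
Hypothesis c0p : c 0%N p.
Hypothesis cSp : forall m, c m.+1 p = false.
Variables (I J : countType) (e : I -> nat) (e' : J -> nat).
Hypothesis e_inj : injective e.
Hypothesis eP : forall m, (essential K c m /\ m <> 0%N) <-> exists i, e i = m.
Hypothesis e'_inj : injective e'.
Hypothesis e'P : forall j, jumps K d j <-> exists i, e' i = j.

(** The c_0(x) and c_(e i)(x) are the compact coordinates, the b_(e' i)(x) the discrete ones. As the
    b_j vanish on K, elements of K adjust the former without affecting the latter. *)
Lemma coordinate_isomorphism : exists f : H -> model I J,
  [/\ {morph f : x y / x * y}, homeomorphism f & f p = model_point I J].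
Proof.
have [b [b_hom b_chain b_jump]] := jump_hom_ex H2 d gK.
have bK j x : K x -> b j x = false.
  by move=> Kx; apply: b_chain; apply: (@chain_sub H d K 0).
have fin_b x : finite_set [set i | b (e' i) x].
  have [n nx] := chain_exhaust H2 nK d_dense x.
  apply: (sub_finite_set (B := e' @^-1` `I_n)).
    move=> i /= bx; rewrite ltnNge; apply/negP => ni.
    by rewrite (jump_chain b_chain ni nx) in bx.
  by apply: finite_preimage; [exact: in2W|exact: finite_II].
pose f x : model I J :=
  ((c 0%N x, fun i => c (e i) x), fset_set [set i | b (e' i) x]).
have f2 x i : (i \in (f x).2) = b (e' i) x.
  by rewrite /f /= in_fset_set//; apply/idP/idP; rewrite inE.
have fM : {morph f : x y / x * y}.
  move=> x y; apply: model_eqP => [|i|j] /=; rewrite ?c_hom//.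
  by rewrite in_fsymdiff !f2 b_hom.
have f1 x : K x -> (forall m, essential K c m -> c m x = false) -> x = 1.
  exact: essential_inj.
have f_ker x : f x = 1 -> x = 1.
  move=> fx1; apply: f1.
    apply: (jump_inj H2 gK nK d_dense b_hom b_chain b_jump).
    by move=> j /e'P[i <-]; rewrite -f2 fx1 in_fset0.
  move=> [_|m Sm]; first exact: (congr1 (fun m => m.1.1) fx1).
  have [i <-] : exists i, e i = m.+1 by apply/eP; split.
  exact: (congr1 (fun m => m.1.2 i) fx1).
have f_inj : injective f.
  move=> x y fxy; rewrite -[x]mul1g -(bmulgg H2 y) -mulgA.
  rewrite (f_ker (y * x)) ?mulg1// fM fxy; exact: model_boolean.
have /choice[g gP] : forall m, exists x, f x = m.
  move=> [[t u] A]; pose n := (\max_(i <- A) (e' i).+1)%N.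
  pose v k := k \in [seq e' i | i <- A].
  have vn k : n <= k -> v k = false.
    move=> nk; apply/negP => /mapP[i iA ki]; move: nk; rewrite ki leqNgt.
    by rewrite /n (big_rem i iA)/= leq_max leqnn.
  have [x nx bx] := jump_surj H2 gK b_hom b_chain b_jump n v.
  pose w k := if k is 0%N then t else `[< exists2 i, e i = k & u i >].
  have [y Ky cy] := essential_surj gK cK c_hom c_open (fun k => w k (+) c k x).
  exists (x * y); apply: model_eqP => [|i|i].
  - have S0 : essential K c 0%N by exists p; split=> // l; rewrite ltn0.
    rewrite /= c_hom cy//.
    by rewrite /w addbC -addbA addbb addbF.
  - have [Sei ei0] := iffRL (eP (e i)) (ex_intro _ i erefl).
    rewrite /= c_hom cy// addbC -addbA addbb addbF /w.
    case ei: (e i) ei0 => [//|k] _.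
    apply/asboolP/idP => [[i' + ui']|ui]; last by exists i.
    by rewrite -ei => /e_inj <-.
  - rewrite f2 b_hom (bK _ _ Ky) addbF.
    have [ni|ni] := ltnP (e' i) n; last first.
      by rewrite (jump_chain b_chain ni nx) -(vn _ ni) /v mem_map.
    rewrite bx// /v ?mem_map//.
    by apply/e'P; exists i.
exists f; split=> //; last first.
  apply: model_eqP => //= [i|i]; last by rewrite f2 bK.
  have [_] := iffRL (eP (e i)) (ex_intro _ i erefl).
  by case: (e i).
exists g; split=> //; first by move=> x; apply: f_inj; rewrite gP.
- move=> x A /(coding_nbhs (@model_coding I J))[n nA].
  (* The index type ['I_n.+1] is inhabited, so that the condition on c_0 is present also for n =
     0. *)
  have : nbhs x [set y | K (x * y) /\ forall k : 'I_n.+1,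
      c 0%N y = c 0%N x /\ cantor_code (f y).1.2 k = cantor_code (f x).1.2 k].
    apply: filterI.
      by apply/nbhs_mulgl; apply: filterS nK => y; rewrite /= bmulgK.
    pose P (k : 'I_n.+1) : set H := [set y | c 0%N y = c 0%N x /\
      cantor_code (f y).1.2 k = cantor_code (f x).1.2 k].
    have := @filter_forall H 'I_n.+1 P (nbhs x) _; apply => k.
    apply: filterI; first exact: bool_hom_near.
    rewrite /cantor_code; case: (pickle_inv k) => [i|]; last exact: filterE.
    by apply: filterS (bool_hom_near x (c_hom (e i)) (c_open (e i))) => y /= ->.
  apply: filterS => y [Kxy cy]; apply: nA.
  apply/agree_pair; split; first (apply/agree_pair; split).
  - by move=> i _ /=; have [-> _] := cy ord0.
  - by move=> i ni; have [_] := cy (Ordinal (ltnW ni : i < n.+1)).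
  - move=> i _ /=; congr pickle; apply/fsetP => j; rewrite !f2.
    by have := bK (e' j) _ Kxy; rewrite b_hom; case: (b _ x) (b _ y) => [] [].
(* Inside K finitely many essential c_l control W, and the corresponding coordinates can be read off
   an initial segment of the code. *)
move=> m W /nbhs_mulgl/(essential_nbhs H2 gK cK nK c_hom c_open c_sep)[n nW].
have [k kP] : exists k, forall m', agree (@model_code I J) k m m' ->
    forall i, e i < n -> m'.1.2 i = m.1.2 i.
  elim: n {nW} => [|n [k kP]]; first by exists 0%N.
  have [[i0 ei0]|nei] := pselect (exists i, e i = n); last first.
    exists k => m' /kP mm' i; rewrite ltnS leq_eqVlt => /predU1P[ei|]; last exact: mm'.
    by case: nei; exists i.
  exists (maxn k (pickle i0).+1) => m' mm' i; rewrite ltnS leq_eqVlt.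
  move=> /predU1P[ei|]; last by apply: kP; apply: agree_leq mm'; rewrite leq_maxl.
  have <- : i0 = i by apply: e_inj; rewrite ei0.
  have [/agree_pair[_ um] _] := iffLR (agree_pair _ _ _ _ _) mm'.
  have := um (pickle i0); rewrite leq_maxr /cantor_code pickleK_inv.
  by move=> /(_ isT); case: (m'.1.2 i0) (m.1.2 i0) => [] [].
(* With k + 1 entries, entry 0 is always compared; it fixes the Z/2 component and the support. *)
apply/(coding_nbhs (@model_coding I J)); exists k.+1 => m' mm'.
rewrite /= -[g m'](bmulgK H2 (g m)); apply: nW.
  apply: (jump_inj H2 gK nK d_dense b_hom b_chain b_jump) => j /e'P[i <-].
  rewrite b_hom -!f2 !gP; have [_ A] := iffLR (agree_pair _ _ _ _ _) mm'.
  by rewrite (pcan_inj pickleK (A 0%N isT)) addbb.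
move=> l ln Sl; rewrite c_hom; have [l0|/eqP l0] := eqVneq l 0%N.
  have [/agree_pair[bm _] _] := iffLR (agree_pair _ _ _ _ _) mm'.
  have := pcan_inj pickleK (bm 0%N isT); rewrite -{1}(gP m) -{1}(gP m') /= l0.
  by move=> ->; rewrite addbb.
have [i ei] := iffLR (eP l) (conj Sl l0).
have := kP m' (agree_leq (leqnSn _) mm') i; rewrite ei => /(_ ln).
rewrite -{1}(gP m) -{1}(gP m') /= ei => ->.
by rewrite addbb.
Qed.

End CoordinateIsomorphism.

Lemma enum_nat_set (S : set nat) :
  (exists n, exists2 e : 'I_n -> nat, injective e &
    forall m, S m <-> exists i, e i = m) \/
  (exists2 e : nat -> nat, injective e & forall m, S m <-> exists i, e i = m).
Proof.
have [[n]|infS] := pselect (finite_set S).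
  rewrite card_eq_sym => /card_set_bijP[f [fS f_inj f_surj]]; left.
  exists n, (fun i : 'I_n => f i).
    by move=> i j /(f_inj _ _ (mem_set (ltn_ord i)) (mem_set (ltn_ord j)))/val_inj.
  move=> m; split=> [/f_surj[i /= ni <-]|[i <-]]; first by exists (Ordinal ni).
  by apply: fS => /=.
right; have : ([set: nat] #= S)%card.
  by rewrite card_eq_le; apply/andP; split; [exact/infiniteP|exact: countableP].
move=> /card_set_bijP[f [fS f_inj f_surj]]; exists f.
  by move=> i j /f_inj; apply; exact: mem_set.
by move=> m; split=> [/f_surj[i _ <-]|[i <-]]; [exists i|exact: fS].
Qed.

(** * Passage from the group to its base, and the classification *)

Section Classification.
Variables (R : realType) (G : topologicalGroupType) (B : basePair).
Hypothesis (B2 : boolean_group B).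
Variable phi : G -> base_prod (tilde_base B2).
Hypothesis phiM : {morph phi : x y / x * y}.
Hypothesis phi_homeo : homeomorphism phi.
Hypothesis G_lc : locally_compact [set: G].
Hypothesis G_polish : polish R G.

Let r (g : G) : B := (phi g).1.1.

Lemma r_continuous : continuous r.
Proof.
have [_ [_ _ cphi _]] := phi_homeo.
move=> g; apply: (@continuous_comp G (base_prod (tilde_base B2)) B phi
  (fun u => u.1.1)).
  exact: cphi.
apply: (@continuous_comp _ (base_prod B) B (fun u => u.1) (fun u => u.1)).
  exact: cvg_fst.
exact: (@cvg_fst B bool).
Qed.

(** As a space, B is a retract of G. This transfers dense sequences, compact neighbourhoods and
    small balls to B, although [r] does not respect products. *)
Lemma base_section : exists2 i : B -> G, continuous i & cancel i r.
Proof.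
have [psi [phiK psiK _ cpsi]] := phi_homeo.
exists (fun x => psi ((x, false), false)); last by move=> x; rewrite /r psiK.
move=> x; apply: (@continuous_comp B (base_prod (tilde_base B2)) G
  (fun x => ((x, false), false)) psi); last exact: cpsi.
apply: (@cvg_pair _ _ _ _ (nbhs ((x, false) : base_prod B)) (nbhs false));
  last exact: cvg_cst.
by apply: (@cvg_pair _ _ _ _ (nbhs x) (nbhs false));
  [exact: cvg_id|exact: cvg_cst].
Qed.

Lemma base_dense : exists d : nat -> B,
  forall (x : B) (V : set B), nbhs x V -> exists j, V (d j).
Proof.
have [i ci ri] := base_section.
have [[A /countable_injP[h h_inj] dA] _] := G_polish.
exists (fun n => r (xget (i 1) [set a | A a /\ h a = n])) => x V xV.
have [||g [Vg Ag]] := dA (r @^-1` V^°).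
- by exists (i x); rewrite /= ri; exact: nbhs_singleton (nbhs_interior xV).
- by apply: open_comp; [move=> g _; exact: r_continuous|exact: open_interior].
exists (h g); case: xgetP => [a _ [Aa ha]|/(_ g)]; last by case.
by rewrite (h_inj _ _ (mem_set Aa) (mem_set Ag) ha); exact: interior_subset.
Qed.

Lemma base_compact_nbhs : exists2 V : set B, compact V & nbhs 1 V.
Proof.
have [i ci ri] := base_section.
have [C] := @G_lc (i 1) Logic.I; rewrite withinET => nC [cC _].
exists (r @` C).
  apply: continuous_compact => //; apply: continuous_subspaceT.
  exact: r_continuous.
apply: (@filterS _ _ _ (i @^-1` C)); last exact: (ci 1).
by move=> x Cx; exists (i x).
Qed.

Lemma base_nbhs_sequence : exists U : nat -> set B,
  (forall n, nbhs 1 (U n)) /\ forall x, (forall n, U n x) -> x = 1.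
Proof.
have [i ci ri] := base_section.
have [_ [M [_ [h [k [hK kK ch ck]]]]]] := G_polish.
pose e x := h (i x).
have ce : continuous e.
  by move=> x; apply: continuous_comp; [exact: ci|exact: ch].
exists (fun n => e @^-1` ball (e 1) n.+1%:R^-1%R); split=> [n|x Ux].
  by apply: ce; apply: nbhsx_ballx; rewrite Num.Theory.invr_gt0.
apply: (can_inj ri); apply: (can_inj hK).
apply/esym/(@mdist_positivity R M)/eqP.
rewrite Order.POrderTheory.eq_le mdist_ge0 andbT Order.TotalTheory.leNgt.
apply/negP => /ltr_add_invr[n]; rewrite GRing.add0r => d_gt.
have := Ux n; rewrite /= ballEmdist /= => d_lt.
by have := Order.POrderTheory.lt_trans d_lt d_gt; rewrite Order.POrderTheory.ltxx.
Qed.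

Let p := bp_point B.

Lemma iso_model_of (I J : countType) :
  (exists f : B -> model I J,
    [/\ {morph f : x y / x * y}, homeomorphism f & f p = model_point I J]) ->
  topgroup_isomorphic G (iso_model I J).
Proof.
move=> fP; apply: (@topgroup_isomorphic_trans _ (base_prod (tilde_base B2))).
  by exists phi.
exact: (@base_pair_isomorphic_tilde B (model_base I J)).
Qed.

Lemma classification :
  (exists n, topgroup_isomorphic G (iso_model 'I_n 'I_0)) \/
  [\/ topgroup_isomorphic G (iso_model nat 'I_0),
      topgroup_isomorphic G (iso_model 'I_0 nat)
    | topgroup_isomorphic G (iso_model nat nat)].
Proof.
have [d d_dense] := base_dense.
have [U [nU U1]] := base_nbhs_sequence.
have [K0 [gK0 cK0 nK0]] : exists K : set B, [/\ subgrp K, compact K & nbhs 1 K].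
  have [V cV nV] := base_compact_nbhs.
  exact: (compact_open_subgroup B2 d_dense cV nV).
have [c [hc oc sc c0p cSp]] :=
  adapted_homs B2 d_dense nU U1 gK0 cK0 nK0 (@bp_neq1 B).
have coord (K : set B) := @coordinate_isomorphism B B2 p d K c d_dense.
(* If B is compact, K = B leaves no jumps, and J is empty. *)
have [cB|ncB] := pselect (compact [set: B]).
  have gB : subgrp [set: B] by split.
  have e'P j : jumps [set: B] d j <-> exists i : 'I_0, (i : nat) = j.
    split=> [nj|[[]//]]; case: nj.
    by apply: (@chain_sub B d [set: B] 0).
  have [[n [e e_inj eP]]|[e e_inj eP]] :=
      enum_nat_set [set m | essential [set: B] c m /\ m <> 0%N].
    left; exists n; apply: iso_model_of.
    exact: (coord _ gB cB filterT Logic.I hc oc sc c0p cSp _ _ e _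
      e_inj eP (@ord_inj 0) e'P).
  right; apply: Or31; apply: iso_model_of.
  exact: (coord _ gB cB filterT Logic.I hc oc sc c0p cSp _ _ e _
    e_inj eP (@ord_inj 0) e'P).
right.
have [dB|ndB] := pselect (discrete_space B).
  (* Position 0 is the only essential one, since c_m(p) = 0 for m > 0. A finite J would make B
     compact. *)
  pose K : set B := [set 1; p].
  have gK : subgrp K.
    split; first by left.
    move=> x y [->|->] [->|->]; rewrite ?mul1g ?mulg1 ?(bmulgg B2).
    + by left.
    + by right.
    + by right.
    + by left.
  have cK : compact K by apply: finite_compact; exact: finite_set2.
  have nK : nbhs 1 K by apply: open_nbhs_nbhs; split; [exact: dB|left].
  have eP m : essential K c m /\ m <> 0%N <-> exists i : 'I_0, (i : nat) = m.
    split=> [[[y [[->|->]]]]|[[]//]]; first by rewrite bool_hom1.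
    by case: m => // m; rewrite cSp.
  have [[n [e' e'_inj e'P]]|[e' e'_inj e'P]] := enum_nat_set (jumps K d).
    have [f [_ /homeomorphism_sym[g hg _] _]] :=
      coord _ gK cK nK (or_intror erefl) hc oc sc c0p cSp _ _ _ e'
      (@ord_inj 0) eP e'_inj e'P.
    by case: ncB; apply: homeomorphism_compact hg _; exact: model_compact.
  apply: Or32; apply: iso_model_of.
  exact: (coord _ gK cK nK (or_intror erefl) hc oc sc c0p cSp _ _ _ e'
      (@ord_inj 0) eP e'_inj e'P).
have [K [gK cK nK Kp]] : exists K : set B, [/\ subgrp K, compact K, nbhs 1 K & K p].
  (* One step of the chain along the constant sequence p adjoins p to [K0]. *)
  exists (chain (fun=> p) K0 1); split.
  - exact: chain_subgrp.
  - exact: chain_compact.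
  - by apply: filterS nK0 => x; left.
  - by right; rewrite bmulgg//; exact: gK0.1.
(* A finite J would make B compact, and a finite I would make it discrete. *)
have [[n [e e_inj eP]]|[e e_inj eP]] :=
    enum_nat_set [set m | essential K c m /\ m <> 0%N];
  have [[m [e' e'_inj e'P]]|[e' e'_inj e'P]] := enum_nat_set (jumps K d);
  have fP := coord _ gK cK nK Kp hc oc sc c0p cSp _ _ e e' e_inj eP e'_inj e'P.
- have [f [_ /homeomorphism_sym[g hg _] _]] := fP.
  by case: ncB; apply: homeomorphism_compact hg _; exact: model_compact.
- have [f [_ /homeomorphism_sym[g hg _] _]] := fP.
  by case: ndB; apply: homeomorphism_discrete hg _; exact: model_discrete.
- have [f [_ /homeomorphism_sym[g hg _] _]] := fP.
  by case: ncB; apply: homeomorphism_compact hg _; exact: model_compact.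
- by apply: Or33; exact: iso_model_of.
Qed.

End Classification.

(** * Exponent 4 and the conclusion *)

Lemma base_prod_expg4 (C : basePair) : (forall x : C, x ^+ 4 = 1) ->
  forall u : base_prod C, u ^+ 4 = 1.
Proof.
(* An element of sign -1 squares to (p, 1), and p is an involution; for sign 1 the exponent of C
   applies. *)
move=> C4 [x [|]]; rewrite !expgS expg0 mulg1; last first.
  move: (C4 x); rewrite !expgS expg0 mulg1.
  by move=> C4x; exact: (congr1 (fun y => (y, false) : base_prod C) C4x).
have qq : bp_point C * bp_point C = 1 by exact: bp_sqr.
rewrite /mul/= mulgV mul1g invgM invgK (mulgA x) (bp_mulC x) mulgK qq.
by [].
Qed.

Lemma lcp_classification (R : realType) (G : topologicalGroupType) :
  lcp_iso_singular R G ->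
  (exists n, topgroup_isomorphic G (iso_model 'I_n 'I_0)) \/
  [\/ topgroup_isomorphic G (iso_model nat 'I_0),
      topgroup_isomorphic G (iso_model 'I_0 nat)
    | topgroup_isomorphic G (iso_model nat nat)].
Proof.
move=> [lcG pG [B [B2 [phi phiM hphi]]]].
exact: (classification phiM hphi lcG pG).
Qed.

Theorem corollary3p13 (R : realType) :
  [/\ (* countably many up to isomorphism *)
      (exists F : nat -> topologicalGroupType,
         (forall n : nat, lcp_iso_singular R (F n)) /\
         (forall G : topologicalGroupType, lcp_iso_singular R G ->
            exists n : nat, topgroup_isomorphic G (F n))),
      (* exactly three infinite ones *)
      (exists K D N : topologicalGroupType,
         [/\ [/\ lcp_iso_singular R K, infinite_set [set: K]
               & compact [set: K]],
             [/\ lcp_iso_singular R D, infinite_set [set: D]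
               & discrete_space D],
             [/\ lcp_iso_singular R N, infinite_set [set: N],
                 ~ compact [set: N] & ~ discrete_space N],
             [/\ ~ topgroup_isomorphic K D, ~ topgroup_isomorphic K N
               & ~ topgroup_isomorphic D N]
           & forall G : topologicalGroupType,
               lcp_iso_singular R G -> infinite_set [set: G] ->
               [\/ topgroup_isomorphic G K, topgroup_isomorphic G D
                 | topgroup_isomorphic G N]]),
      (* exponent 4 and total disconnectedness *)
      (forall G : topologicalGroupType, lcp_iso_singular R G ->
         (forall x : G, x ^+ 4 = 1) /\ totally_disconnected [set: G])
    & (* the finite ones are determined by their cardinality *)
      (forall G H : topologicalGroupType,
         lcp_iso_singular R G -> lcp_iso_singular R H ->
         finite_set [set: G] -> finite_set [set: H] ->
         ([set: G] #= [set: H])%card -> topgroup_isomorphic G H)].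
Proof.
have not_compact (I : countType) (G : topologicalGroupType) : compact [set: G] ->
    ~ topgroup_isomorphic G (iso_model I nat).
  move=> cG [f _ hf]; apply: (@iso_model_not_compact I).
  exact: homeomorphism_compact hf cG.
have finite_iso (G H : topologicalGroupType) : topgroup_isomorphic G H ->
    finite_set [set: G] -> finite_set [set: H].
  move=> [f _ [g [fK gK _ _]]] finG; apply: contrapT.
  by move=> /(inj_infinite_set (can_inj gK)); apply.
split.
- pose F n := match n with
    | 0 => iso_model nat 'I_0 | 1 => iso_model 'I_0 nat | 2 => iso_model nat nat
    | k.+3 => iso_model 'I_k 'I_0 end.
  exists F; split; first by move=> [|[|[|n]]]; exact: iso_model_lcp.
  move=> G /lcp_classification[[n Gn]|[GK|GD|GN]].
  + by exists n.+3.
  + by exists 0%N.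
  + by exists 1%N.
  + by exists 2%N.
- exists (iso_model nat 'I_0), (iso_model 'I_0 nat), (iso_model nat nat); split.
  + split; [exact: iso_model_lcp|exact: iso_model_infinitel|exact: iso_model_compact].
  + split; [exact: iso_model_lcp|exact: iso_model_infiniter|exact: iso_model_discrete].
  + split; [exact: iso_model_lcp|exact: iso_model_infinitel| |].
      exact: iso_model_not_compact.
    exact: iso_model_not_discrete.
  + split; [apply: not_compact|apply: not_compact|]; try exact: iso_model_compact.
    move=> [f _ hf]; apply: (@iso_model_not_discrete nat).
    exact: homeomorphism_discrete hf (@iso_model_discrete _ _).
  + move=> G /lcp_classification[[n /topgroup_isomorphic_sym Gn]|//] infG.
    by case: infG; exact: finite_iso Gn (@iso_model_finite n).
- move=> G lcpG; split.
    have [_ _ [B [B2 [phi phiM [psi [phiK _ _ _]]]]]] := lcpG.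
    have phi1 : phi 1 = 1 by apply: (mulgI (phi 1)); rewrite -phiM !mulg1.
    move=> x; apply: (can_inj phiK); rewrite phi1 !expgS expg0 mulg1 !phiM.
    (* The construction preserves exponent 4 and is applied twice, starting from the Boolean group
       B. *)
    have expn4 := @base_prod_expg4 (tilde_base B2).
    rewrite -(expn4 _ (phi x)) ?expgS ?expg0 ?mulg1//.
    apply: base_prod_expg4 => y.
    by rewrite !expgS expg0 !(bmulgK B2).
  (* The coding of the model separates points by clopen sets, which are pulled back to G. *)
  apply: zero_dimension_totally_disconnected => x y /eqP xy.
  have clop (I J : countType) : topgroup_isomorphic G (iso_model I J) ->
      exists U : set G, [/\ clopen U, U x & ~ U y].
    move=> [f _ [g [fK _ cf _]]].
    have fxy : f x != f y by apply/eqP => /(can_inj fK).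
    have [U [cU Ux Uy]] :=
      coding_zero_dimensional (@iso_model_coding I J) fxy.
    by exists (f @^-1` U); split=> //; exact: preimage_clopen.
  by have [[n /clop]|[/clop|/clop|/clop]] := lcp_classification lcpG.
- move=> G H lG lH fG fH cGH.
  have fin_class L : lcp_iso_singular R L -> finite_set [set: L] ->
      exists n, topgroup_isomorphic L (iso_model 'I_n 'I_0).
    move=> /lcp_classification[//|LI] fL.
    case: LI => /finite_iso/(_ fL) finI; exfalso; move: finI.
    + exact: iso_model_infinitel.
    + exact: iso_model_infiniter.
    + exact: iso_model_infinitel.
  have [m Gm] := fin_class G lG fG; have [n Hn] := fin_class H lH fH.
  have card_le (L L' : topologicalGroupType) k l :
      topgroup_isomorphic L (iso_model 'I_k 'I_0) ->
      topgroup_isomorphic L' (iso_model 'I_l 'I_0) ->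
      ([set: L] #<= [set: L'])%card -> k <= l.
    move=> [f _ [f' [_ f'K _ _]]] [g _ [g' [gK _ _ _]]] /card_le_setT[h h_inj].
    apply: (@iso_model_card_le k l (g \o h \o f')).
    apply: inj_comp; last exact: can_inj f'K.
    by apply: inj_comp => //; exact: can_inj gK.
  have mn : m = n.
    move: cGH; rewrite card_eq_le => /andP[GH HG]; apply/eqP.
    by rewrite eqn_leq (card_le _ _ _ _ Gm Hn GH) (card_le _ _ _ _ Hn Gm HG).
  rewrite mn in Gm; apply: topgroup_isomorphic_trans Gm _.
  exact: topgroup_isomorphic_sym.
Qed.
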